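(* Let $X_1,X_2,\dots$ be i.i.d. with distribution $P_0$ on $\mathcal X$, and let $\theta^*$ be an interior point of $\Theta\subseteq\mathbb R^p$. Let $\boldsymbol\alpha=(\alpha_i)_{i\ge1}$ be a deterministic sequence of positive weights with finite second moment, i.e. $\limsup_{n}\frac1n\sum_{i=1}^n\alpha_i^2<\infty$. Suppose the prior density $\pi$ is continuous and strictly positive on a neighborhood of $\theta^*$, and that the Weighted M-LAN condition and the $\sqrt n$-concentration condition (both defined in the context) hold. Then $$d_{\mathrm{TV}}\Big(\pi_n^\rho(\cdot\mid F_n^{\boldsymbol\alpha}),\ \phi\big(\cdot\mid \hat\theta^{\boldsymbol\alpha}_\rho,\ V_{\theta^*}^{-1}/(\bar\alpha_n n)\big)\Big)\to 0$$ in $P_0$-probability, where $\phi(\cdot\mid\mu,\Sigma)$ is the $N(\mu,\Sigma)$ density, $\bar\alpha_n=n^{-1}\sum_{i=1}^n\alpha_i$, and $V_{\theta^*}$ is the positive definite matrix from the Weighted M-LAN condition.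
   Context: Loss $\rho:\mathcal X\times\Theta\to\mathbb R_{\ge0}$, $\Theta\subseteq\mathbb R^p$, with score $\psi(x,\theta)=\nabla_\theta\rho(x,\theta)$. Weighted empirical measure: $F_n^{\boldsymbol\alpha}=\frac1n\sum_{i=1}^n\alpha_i\delta_{X_i}$ (not necessarily a probability measure), so $\mathbb E_{F_n^{\boldsymbol\alpha}}[g(X)]=\frac1n\sum_i\alpha_i g(X_i)$. Weighted M-estimator $\hat\theta^{\boldsymbol\alpha}_\rho$: a solution of $\frac1n\sum_{i=1}^n\alpha_i\psi(X_i,\theta)=0$. Weighted M-posterior: the density $$\pi_n^\rho(\theta\mid F_n^{\boldsymbol\alpha})=\frac{\exp(-\sum_{i=1}^n\alpha_i\rho(X_i,\theta))\pi(\theta)}{\int_\Theta\exp(-\sum_{i=1}^n\alpha_i\rho(X_i,\theta'))\pi(\theta')\,d\theta'}.$$ Weighted M-LAN condition: there is a positive definite matrix $V_{\theta^*}$ such that, with $$R_{n,\boldsymbol\alpha}(h)=\sum_{i=1}^n\alpha_i\big(\rho(X_i,\theta^* )-\rho(X_i,\theta^*+h/\sqrt n)\big)-h^\top\bar\alpha_nV_{\theta^*}\sqrt n(\hat\theta^{\boldsymbol\alpha}_\rho-\theta^* )+\tfrac12h^\top\bar\alpha_nV_{\theta^*}h,$$ $\sup_{h\in K}|R_{n,\boldsymbol\alpha}(h)|\to0$ in $P_0$-probability for every compact $K\subseteq\mathbb R^p$. Concentration condition: for every sequence $r_n\to\infty$, $\mathbb E_{P_0}\big[\int_\Theta\mathbf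 1\{\|\sqrt n(\theta-\theta^* )\|>r_n\}\pi_n^\rho(\theta\mid F_n^{\boldsymbol\alpha})d\theta\big]\to0$. $d_{\mathrm{TV}}$ is total variation distance. *)

(* Defs.v *)
From HB Require Import structures.
From mathcomp Require Import all_boot all_order all_algebra.
From mathcomp Require Import all_classical all_reals all_analysis.

Set Implicit Arguments.
Unset Strict Implicit.
Unset Printing Implicit Defensive.

Import Order.TTheory GRing.Theory Num.Theory.
Local Open Scope classical_set_scope.
Local Open Scope ring_scope.

Section Defs.
Variable R : realType.
Variable p : nat.
Notation vec := (p.-tuple R).

Definition tadd (h k : vec) : vec := [tuple tnth h i + tnth k i | i < p].
Definition tsub (h k : vec) : vec := [tuple tnth h i - tnth k i | i < p].
Definition tscale (a : R) (h : vec) : vec := [tuple a * tnth h i | i < p].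
Definition tdot (h k : vec) : R := \sum_(i < p) tnth h i * tnth k i.
Definition enorm (h : vec) : R := Num.sqrt (\sum_(i < p) tnth h i ^+ 2).
Definition trow (h : vec) : 'rV[R]_p := \row_i tnth h i.
Definition bform (M : 'M[R]_p) (h k : vec) : R :=
  (trow h *m M *m (trow k)^T) ord0 ord0.
Definition qform (M : 'M[R]_p) (h : vec) : R := bform M h h.

Definition posdef (M : 'M[R]_p) : Prop :=
  M^T = M /\ forall h : vec, h <> [tuple 0 | _ < p] -> 0 < qform M h.

Definition topen (U : set vec) : Prop :=
  forall x, U x -> exists2 r : R, 0 < r & forall y, enorm (tsub y x) < r -> U y.
Definition tcompact (K : set vec) : Prop :=
  forall (I : Type) (U : I -> set vec), (forall i, topen (U i)) ->
    K `<=` \bigcup_i U i ->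
    exists (m : nat) (f : 'I_m -> I), K `<=` \bigcup_k U (f k).
Definition tinterior (A : set vec) (x : vec) : Prop :=
  exists2 r : R, 0 < r & forall y, enorm (tsub y x) < r -> A y.
Definition tcont_at (f : vec -> R) (x : vec) : Prop :=
  forall eps : R, 0 < eps -> exists2 d : R, 0 < d &
    forall y, enorm (tsub y x) < d -> `|f y - f x| < eps.
Definition grad_at (f : vec -> R) (x g : vec) : Prop :=
  forall eps : R, 0 < eps -> exists2 d : R, 0 < d &
    forall h, enorm h < d -> `|f (tadd x h) - f x - tdot g h| <= eps * enorm h.

Definition box (a b : vec) : set vec :=
  [set x | forall i, tnth a i <= tnth x i <= tnth b i].
Definition is_lebesgue (lam : {measure set vec -> \bar R}) : Prop :=
  forall a b : vec, (forall i, tnth a i <= tnth b i) ->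
    lam (box a b) = (\prod_(i < p) (tnth b i - tnth a i))%:E.

Definition gauss_density (mu : vec) (Sigma : 'M[R]_p) (x : vec) : R :=
  (2 * pi) `^ (- (p%:R / 2)) * (\det Sigma) `^ (- (1 / 2)) *
  expR (- (1 / 2) * qform (invmx Sigma) (tsub x mu)).

Definition dTV (lam : {measure set vec -> \bar R}) (f g : vec -> R) : \bar R :=
  ereal_sup [set `| (\int[lam]_(x in A) (f x)%:E - \int[lam]_(x in A) (g x)%:E) |%E
            | A in [set A : set vec | measurable A]].
End Defs.

Section Prob.
Variable R : realType.

Definition outerP d (Om : measurableType d) (P : probability Om R)
  (A : set Om) : \bar R :=
  ereal_inf [set P B | B in [set B : set Om | measurable B /\ A `<=` B]].

(** X_1, X_2, ... (indexed from 0) are i.i.d. with law P0 *)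
Definition iid d (Om : measurableType d) (P : probability Om R)
  dX (XX : measurableType dX) (X : nat -> Om -> XX) (P0 : probability XX R)
  : Prop :=
  [/\ forall i, measurable_fun setT (X i),
      forall i (A : set XX), measurable A -> P (X i @^-1` A) = P0 A &
      forall (S : seq nat) (A : nat -> set XX), uniq S ->
        (forall i, measurable (A i)) ->
        P (\bigcap_(i in [set` S]) (X i @^-1` A i)) =
        (\prod_(i <- S) fine (P (X i @^-1` A i)))%:E].
End Prob.

Section Model.
Variables (R : realType) (p : nat) (dX : measure_display) (XX : measurableType dX).
Variables (d : measure_display) (Om : measurableType d).
Notation vec := (p.-tuple R).
Variables (rho : XX -> vec -> R) (alpha : nat -> R) (X : nat -> Om -> XX).

Definition wloss (n : nat) (w : Om) (theta : vec) : R :=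
  \sum_(i < n) alpha i * rho (X i w) theta.

Definition alphabar (n : nat) : R := (n%:R)^-1 * \sum_(i < n) alpha i.

Definition mposterior (lam : {measure set vec -> \bar R}) (Theta : set vec)
  (prior : vec -> R) (n : nat) (w : Om) (theta : vec) : R :=
  \1_Theta theta * (expR (- wloss n w theta) * prior theta) /
  fine (\int[lam]_(t in Theta) (expR (- wloss n w t) * prior t)%:E).

Definition solves_est_eq (Theta : set vec) (n : nat) (w : Om) (th : vec) : Prop :=
  tinterior Theta th /\
  exists psi : nat -> vec,
    (forall i, (i < n)%N -> grad_at (rho (X i w)) th (psi i)) /\
    [tuple (n%:R)^-1 * \sum_(i < n) alpha i * tnth (psi i) j | j < p]
      = [tuple 0 | _ < p].

Definition lan_rem (V : 'M[R]_p) (thetas : vec) (thhat : nat -> Om -> vec)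
  (n : nat) (w : Om) (h : vec) : R :=
  \sum_(i < n) alpha i *
     (rho (X i w) thetas - rho (X i w) (tadd thetas (tscale (Num.sqrt n%:R)^-1 h)))
  - alphabar n * bform V h (tscale (Num.sqrt n%:R) (tsub (thhat n w) thetas))
  + (1 / 2) * alphabar n * qform V h.
End Model.

(* Main.v *)
Require Import Defs.
From HB Require Import structures.
From mathcomp Require Import all_boot all_order all_algebra.
From mathcomp Require Import all_classical all_reals all_analysis.
From mathcomp Require Import measurable_realfun.
From mathcomp Require Import ring lra.

Import Order.TTheory GRing.Theory Num.Theory.
Import numFieldNormedType.Exports.
Local Open Scope classical_set_scope.
Local Open Scope ring_scope.

(** The posterior mass of a ball [B] of radius of order [1 / sqrt n] around
[thetas] is close to 1 by the concentration condition, and on the seven times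
larger ball the posterior density is, by the LAN expansion and the continuity
of the prior, nearly proportional to the normal density [g].  Neither a lower
bound for [alphabar] nor tightness of [sqrt n (thhat - thetas)] is assumed; both
are consequences.  Indeed [g] gives little mass to the annulus around [B], and
comparing [B] with its translates inside the annulus bounds the precision of
[g] from below and keeps its mean near [thetas], so that [g] has a small mass
outside the large ball.  Hence the proportionality constant is close to 1 and
the total variation distance is small.  Balls are taken for the norm of [V]. *)

(** The number 7 balances two estimates. With [c] the factor of [V] in the precision matrix of [g],
    translating by [3 * r] costs the factor [expR (- (9 / 2) * c * r ^ 2)], which the small annulus
    forces to be small. A mean within [5 / 2 * r] of [thetas] leaves a distance of [9 / 2 * r]
    outside radius [7 * r], and a quarter of [c * (9 / 2 * r) ^ 2] still exceeds
    [(9 / 2) * c * r ^ 2]. So the smallness extracted from the annulus is what the tail needs. The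
    norm of [V] makes this possible: the level sets of [g] are balls of that norm, hence every
    exponent depends on [c] and on distances only. The measure [lam] is known only through its
    values on boxes. Uniqueness on the sigma-algebra generated by boxes gives translation
    invariance, and lets an iterated product measure replace [lam] wherever Tonelli's theorem is
    used. The concentration condition speaks of radii tending to infinity; it is turned into one
    fixed radius, so that the LAN expansion is used on a single compact set. *)

(** * Quadratic forms on tuples and the norm of a positive definite matrix *)

Section TupleForms.
Context {R : realType} {p : nat}.
Implicit Types (M V : 'M[R]_p) (h k v : p.-tuple R) (a : R).

Definition tzero : p.-tuple R := [tuple 0 | _ < p].

Lemma trow_inj : injective (@trow R p).
Proof.
by move=> h k /rowP e; apply: eq_from_tnth => i; have := e i; rewrite !mxE.
Qed.

Lemma trow0 : trow tzero = 0.
Proof. by apply/rowP => i; rewrite !mxE tnth_mktuple. Qed.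

Lemma trowD h k : trow (tadd h k) = trow h + trow k.
Proof. by apply/rowP => i; rewrite !mxE tnth_mktuple. Qed.

Lemma trowB h k : trow (tsub h k) = trow h - trow k.
Proof. by apply/rowP => i; rewrite !mxE tnth_mktuple. Qed.

Lemma trowZ a h : trow (tscale a h) = a *: trow h.
Proof. by apply/rowP => i; rewrite !mxE tnth_mktuple. Qed.

Definition trowE := (trow0, trowD, trowB, trowZ).

Lemma mx11D (A B : 'M[R]_1) : (A + B) ord0 ord0 = A ord0 ord0 + B ord0 ord0.
Proof. by rewrite mxE. Qed.

Lemma mx11Z (a : R) (A : 'M[R]_1) : (a *: A) ord0 ord0 = a * A ord0 ord0.
Proof. by rewrite mxE. Qed.

Lemma mx11B (A B : 'M[R]_1) : (A - B) ord0 ord0 = A ord0 ord0 - B ord0 ord0.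
Proof. by rewrite !mxE. Qed.

Lemma mx11M (A B : 'M[R]_1) : (A *m B) ord0 ord0 = A ord0 ord0 * B ord0 ord0.
Proof. by rewrite mxE big_ord1. Qed.

Lemma mx11_scalar (a : R) : (a%:M : 'M[R]_1) ord0 ord0 = a.
Proof. by rewrite mxE eqxx. Qed.

Lemma bformDl M h k v : bform M (tadd h k) v = bform M h v + bform M k v.
Proof. by rewrite /bform trowD !mulmxDl mxE. Qed.

Lemma bformDr M h k v : bform M v (tadd h k) = bform M v h + bform M v k.
Proof. by rewrite /bform trowD linearD mulmxDr mxE. Qed.

Lemma bformBl M h k v : bform M (tsub h k) v = bform M h v - bform M k v.
Proof. by rewrite /bform trowB !mulmxBl !mxE. Qed.

Lemma bformBr M h k v : bform M v (tsub h k) = bform M v h - bform M v k.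
Proof. by rewrite /bform trowB linearB mulmxBr !mxE. Qed.

Lemma bformZl M a h v : bform M (tscale a h) v = a * bform M h v.
Proof. by rewrite /bform trowZ -!scalemxAl mxE. Qed.

Lemma bformZr M a h v : bform M v (tscale a h) = a * bform M v h.
Proof. by rewrite /bform trowZ linearZ -scalemxAr mxE. Qed.

Lemma bform0l M v : bform M tzero v = 0.
Proof. by rewrite /bform trow0 !mul0mx mxE. Qed.

Lemma bformC M h k : M^T = M -> bform M h k = bform M k h.
Proof.
move=> sM; rewrite /bform -[in LHS](trmxK (trow h *m M *m (trow k)^T)) mxE.
by rewrite !trmx_mul trmxK sM mulmxA.
Qed.

Lemma bformZm M a h k : bform (a *: M) h k = a * bform M h k.
Proof. by rewrite /bform -scalemxAr -scalemxAl mxE. Qed.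

Lemma qformZm M a h : qform (a *: M) h = a * qform M h.
Proof. exact: bformZm. Qed.

Lemma qformZ M a h : qform M (tscale a h) = a ^+ 2 * qform M h.
Proof. by rewrite /qform bformZl bformZr mulrA. Qed.

Lemma qformD M h k : M^T = M ->
  qform M (tadd h k) = qform M h + 2 * bform M h k + qform M k.
Proof.
by move=> sM; rewrite /qform bformDl !bformDr (bformC M k h sM); ring.
Qed.

Lemma qformB M h k : M^T = M ->
  qform M (tsub h k) = qform M h - 2 * bform M h k + qform M k.
Proof.
by move=> sM; rewrite /qform bformBl !bformBr (bformC M k h sM); ring.
Qed.

Lemma qform_tzero M : qform M tzero = 0.
Proof. exact: bform0l. Qed.

Lemma bform_sum M h k :
  bform M h k = \sum_(i < p) \sum_(j < p) tnth h i * M i j * tnth k j.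
Proof.
rewrite /bform mxE exchange_big/=; apply: eq_bigr => j _.
rewrite !mxE mulr_suml; apply: eq_bigr => i _.
by rewrite !mxE.
Qed.

Lemma enorm_ge0 h : 0 <= enorm h.
Proof. exact: sqrtr_ge0. Qed.

Lemma tnth_le_enorm h i : `|tnth h i| <= enorm h.
Proof.
rewrite -sqrtr_sqr ler_sqrt ?sqr_ge0//; last by apply: sumr_ge0 => j _; exact: sqr_ge0.
rewrite (bigD1 i)//= lerDl; apply: sumr_ge0 => j _; exact: sqr_ge0.
Qed.

Lemma qform_le_enorm M h :
  qform M h <= (\sum_(i < p) \sum_(j < p) `|M i j|) * enorm h ^+ 2.
Proof.
rewrite /qform bform_sum mulr_suml; apply: ler_sum => i _.
rewrite mulr_suml; apply: ler_sum => j _.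
apply: (le_trans (ler_norm _)); rewrite !normrM mulrAC mulrC expr2.
by apply: ler_wpM2l => //; apply: ler_pM => //; exact: tnth_le_enorm.
Qed.

Lemma sqr_enorm h : enorm h ^+ 2 = qform 1%:M h.
Proof.
rewrite sqr_sqrtr; last by apply: sumr_ge0 => j _; exact: sqr_ge0.
rewrite /qform bform_sum; apply: eq_bigr => i _.
rewrite (bigD1 i)//= big1 ?addr0; first by rewrite mxE eqxx mulr1 expr2.
by move=> j ji; rewrite mxE eq_sym (negbTE ji) mulr0 mul0r.
Qed.

Section posdef.
Variable V : 'M[R]_p.
Hypothesis Vpos : posdef V.

Let sV : V^T = V. Proof. by case: Vpos. Qed.

Lemma posdef_qform_ge0 h : 0 <= qform V h.
Proof.
have [->|h0] := pselect (h = tzero); first by rewrite qform_tzero.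
by case: Vpos => _ /(_ h h0)/ltW.
Qed.

Lemma posdef_qform_eq0 h : qform V h = 0 -> h = tzero.
Proof.
by move=> q0; apply: contrapT => /(Vpos.2); rewrite q0 ltxx.
Qed.

Lemma posdef_cauchy_schwarz h k : bform V h k ^+ 2 <= qform V h * qform V k.
Proof.
have [k0|k0] := eqVneq (qform V k) 0.
  rewrite k0 mulr0 (posdef_qform_eq0 _ k0) bformC// bform0l.
  by rewrite expr0n.
have kp : 0 < qform V k by rewrite lt_def k0 posdef_qform_ge0.
(* The residual of projecting [h] on [k], multiplied by [qform V k] to avoid a division. *)
have := posdef_qform_ge0 (tsub (tscale (qform V k) h) (tscale (bform V h k) k)).
rewrite qformB// bformZl bformZr !qformZ => H.
have {}H : 0 <= qform V k * (qform V h * qform V k - bform V h k ^+ 2).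
  apply: le_trans H _; rewrite le_eqVlt; apply/orP; left; apply/eqP; ring.
by rewrite pmulr_rge0// subr_ge0 in H.
Qed.

Definition qnorm h := Num.sqrt (qform V h).

Lemma qnorm_ge0 h : 0 <= qnorm h. Proof. exact: sqrtr_ge0. Qed.

Lemma sqr_qnorm h : qnorm h ^+ 2 = qform V h.
Proof. by rewrite sqr_sqrtr// posdef_qform_ge0. Qed.

Lemma qnormZ a h : qnorm (tscale a h) = `|a| * qnorm h.
Proof. by rewrite /qnorm qformZ sqrtrM ?sqr_ge0// sqrtr_sqr. Qed.

Lemma bform_le_qnorm h k : `|bform V h k| <= qnorm h * qnorm k.
Proof.
rewrite -ler_sqr ?nnegrE ?mulr_ge0 ?qnorm_ge0//.
by rewrite exprMn !sqr_qnorm real_normK ?num_real// posdef_cauchy_schwarz.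
Qed.

Lemma qnormD h k : qnorm (tadd h k) <= qnorm h + qnorm k.
Proof.
rewrite -ler_sqr ?nnegrE ?addr_ge0 ?qnorm_ge0//.
rewrite sqr_qnorm qformD// sqrrD !sqr_qnorm lerD2r lerD2l -[leRHS]mulr_natl.
by rewrite ler_pM2l//; apply: le_trans (ler_norm _) (bform_le_qnorm _ _).
Qed.

Lemma qnorm_ge_sub h k : qnorm h - qnorm k <= qnorm (tsub h k).
Proof.
rewrite lerBlDr; have -> : h = tadd (tsub h k) k.
  by apply: trow_inj; rewrite !trowE subrK.
apply: le_trans (qnormD _ _) _.
by have -> : tadd (tsub h k) k = h by apply: trow_inj; rewrite !trowE subrK.
Qed.

(** Each row of the left kernel annihilates the quadratic form, hence is zero by definiteness. *)
Lemma posdef_unitmx : V \in unitmx.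
Proof.
rewrite -row_free_unit -kermx_eq0; apply/eqP/row_matrixP => i.
rewrite row0; set u := row i _.
have uV : u *m V = 0.
  by apply/sub_kermxP; exact: row_sub.
pose t : p.-tuple R := [tuple u ord0 j | j < p].
have tu : trow t = u by apply/rowP => j; rewrite mxE tnth_mktuple.
rewrite -tu (_ : t = tzero) ?trow0//; apply: posdef_qform_eq0.
by rewrite /qform /bform tu uV mul0mx mxE.
Qed.

(** The coordinate [i] is the [V]-inner product with row [i] of the inverse of [V], so
    Cauchy-Schwarz bounds it. This puts balls of the norm of [V] inside cubes, without a compactness
    argument. *)
Lemma posdef_coord_bound :
  exists2 C : R, 0 < C & forall h i, `|tnth h i| <= C * qnorm h.
Proof.
pose w (i : 'I_p) : p.-tuple R := [tuple invmx V i j | j < p].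
have wE i h : bform V (w i) h = tnth h i.
  rewrite /bform (_ : trow (w i) = row i (invmx V)); last first.
    by apply/rowP => j; rewrite !mxE tnth_mktuple.
  by rewrite -row_mul mulVmx ?posdef_unitmx// -row_mul mul1mx !mxE.
exists (1 + \sum_i qnorm (w i)).
  by rewrite ltr_pwDl// sumr_ge0// => i _; exact: qnorm_ge0.
move=> h i; rewrite -wE; apply: le_trans (bform_le_qnorm _ _) _.
apply: ler_wpM2r; first exact: qnorm_ge0.
rewrite (bigD1 i)//= addrCA lerDl addr_ge0// sumr_ge0// => j _; exact: qnorm_ge0.
Qed.

(** The other half of the equivalence of norms; it transfers the concentration condition, stated
    with the Euclidean norm, to balls of [V]. *)
Lemma qnorm_le_enorm : exists2 C : R, 0 < C & forall h, qnorm h <= C * enorm h.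
Proof.
set S := \sum_(i < p) \sum_(j < p) `|V i j|.
have S0 : 0 <= S by apply: sumr_ge0 => i _; apply: sumr_ge0 => j _.
exists (Num.sqrt S + 1); first by rewrite ltr_wpDl ?sqrtr_ge0.
move=> h; apply: (@le_trans _ _ (Num.sqrt S * enorm h)).
  rewrite -ler_sqr ?nnegrE ?qnorm_ge0 ?mulr_ge0 ?enorm_ge0 ?sqrtr_ge0//.
  by rewrite sqr_qnorm exprMn sqr_sqrtr//; exact: qform_le_enorm.
by rewrite ler_wpM2r ?enorm_ge0// lerDl.
Qed.

End posdef.
End TupleForms.
Arguments tzero {R p}.

(** * Schur complements and positivity of the determinant *)

Section Schur.
Context {R : realType} {p : nat}.
Implicit Types (A : 'M[R]_p.+1) (t : p.-tuple R) (x : R).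

Definition pivot A : R := (A : 'M[R]_(1 + p)) ord0 ord0.
Definition pivot_row A : 'rV[R]_p := ursubmx (A : 'M[R]_(1 + p)).
Definition schur A : 'M[R]_p :=
  drsubmx (A : 'M[R]_(1 + p)) - (pivot A)^-1 *: ((pivot_row A)^T *m pivot_row A).
Definition schur_shift A t : R :=
  (pivot A)^-1 * (pivot_row A *m (trow t)^T) ord0 ord0.

Definition tcons x t : p.+1.-tuple R := [the p.+1.-tuple R of x :: t].

Lemma trow_tcons x t : trow (tcons x t) = row_mx x%:M (trow t) :> 'rV[R]_(1 + p).
Proof.
apply/rowP => i; rewrite mxE; case: (splitP i) => j ij.
  rewrite (_ : i = lshift p j); last exact: val_inj.
  rewrite row_mxEl mxE [j]ord1 eqxx mulr1n.
  by rewrite (_ : lshift p 0 = ord0)//; exact: val_inj.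
rewrite (_ : i = rshift 1 j); last exact: val_inj.
rewrite row_mxEr mxE (_ : rshift 1 j = lift ord0 j); last exact: val_inj.
by rewrite tnthS.
Qed.

Lemma sym_block A : A^T = A ->
  A = block_mx (pivot A)%:M (pivot_row A) (pivot_row A)^T
        (drsubmx (A : 'M[R]_(1 + p))) :> 'M[R]_(1 + p).
Proof.
move=> sA; rewrite -[LHS](@submxK _ 1 p 1 p); congr block_mx.
  apply/matrixP => i j; rewrite !ord1 !mxE /pivot eqxx mulr1n.
  by congr (A _ _); exact: val_inj.
by rewrite /pivot_row trmx_ursub; congr (@dlsubmx _ 1 p 1 p _); rewrite sA.
Qed.

Lemma block_form (a x : R) (b u : 'rV[R]_p) (D : 'M[R]_p) :
  (row_mx x%:M u *m block_mx a%:M b b^T D *m (row_mx x%:M u)^T)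
    (ord0 : 'I_1) (ord0 : 'I_1) =
  a * x ^+ 2 + 2 * x * (b *m u^T) ord0 ord0 + (u *m D *m u^T) ord0 ord0.
Proof.
rewrite mul_row_block tr_row_mx mul_row_col tr_scalar_mx.
have buT : u *m b^T = b *m u^T.
  rewrite -[LHS]trmxK trmx_mul trmxK.
  by apply/matrixP => i j; rewrite mxE !ord1.
rewrite buT mul_scalar_mx scale_scalar_mx !mulmxDl -scalar_mxM mul_scalar_mx.
rewrite -scalemxAl mul_mx_scalar !mx11D.
by rewrite mx11Z mx11_scalar; ring.
Qed.

Lemma qform_tcons A x t : A^T = A ->
  qform A (tcons x t) = pivot A * x ^+ 2 +
    2 * x * (pivot_row A *m (trow t)^T) ord0 ord0 +
    (trow t *m drsubmx (A : 'M[R]_(1 + p)) *m (trow t)^T) ord0 ord0.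
Proof.
move=> sA; rewrite /qform /bform trow_tcons -block_form.
exact: (congr1 (fun M : 'M[R]_(1 + p) => (row_mx x%:M (trow t) *m M *m
  (row_mx x%:M (trow t))^T) ord0 ord0) (sym_block _ sA)).
Qed.

(** Completing the square in the first coordinate: for fixed [t], the kernel in [x] is a
    one-dimensional Gaussian of precision [pivot A] centred at [- schur_shift A t]. *)
Lemma qform_schur A x t : A^T = A -> pivot A != 0 ->
  qform A (tcons x t) =
  pivot A * (x + schur_shift A t) ^+ 2 + qform (schur A) t.
Proof.
move=> sA a0; rewrite qform_tcons// /qform /bform /schur /schur_shift.
set a := pivot A in a0 *; set b := pivot_row A; set D := drsubmx _.
set u := trow t.
have buT : u *m b^T = b *m u^T.
  rewrite -[LHS]trmxK trmx_mul trmxK.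
  by apply/matrixP => i j; rewrite mxE !ord1.
rewrite mulmxBr mulmxBl -scalemxAr -scalemxAl mulmxA buT -(mulmxA _ b).
set c := b *m u^T.
by rewrite mx11B mx11Z mx11M; field.
Qed.

(** Block elimination factors [A] into a unipotent lower triangular matrix and an upper triangular
    one with diagonal blocks [pivot A] and [schur A]. *)
Lemma det_schur A : A^T = A -> pivot A != 0 ->
  \det A = pivot A * \det (schur A).
Proof.
move=> sA a0.
have e : A = (block_mx 1%:M 0 ((pivot A)^-1 *: (pivot_row A)^T) 1%:M : 'M[R]_(1 + p))
   *m block_mx (pivot A)%:M (pivot_row A) 0 (schur A) :> 'M[R]_(1 + p).
  rewrite [LHS](sym_block _ sA) mulmx_block !mul1mx !mul0mx !addr0.
  rewrite mul_mx_scalar scalerA divff// scale1r /schur -scalemxAl addrC subrK//.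
transitivity (\det (A : 'M[R]_(1 + p))); first by [].
by rewrite [in LHS]e det_mulmx det_lblock det_ublock !det1 !mul1r det_scalar1.
Qed.

Lemma tcons_eq0 x t : tcons x t = tzero -> x = 0 /\ t = tzero.
Proof.
move=> e; split.
  by have := congr1 (fun h => tnth h ord0) e; rewrite tnth_mktuple.
apply: eq_from_tnth => i; have := congr1 (fun h => tnth h (lift ord0 i)) e.
by rewrite tnthS !tnth_mktuple.
Qed.

Lemma posdef_pivot_gt0 A : posdef A -> 0 < pivot A.
Proof.
move=> [sA pA].
have := pA (tcons 1 tzero) _; rewrite qform_tcons// trow0 trmx0 !mulmx0.
rewrite expr1n mulr1 !mxE mulr0 !addr0; apply.
by move=> /tcons_eq0[/eqP]; rewrite oner_eq0.
Qed.

Lemma posdef_schur A : posdef A -> posdef (schur A).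
Proof.
move=> pA; have a0 := posdef_pivot_gt0 _ pA; case: pA => sA pA; split.
  rewrite /schur linearB/= linearZ/= trmx_mul trmxK trmx_drsub.
  by congr (@drsubmx _ 1 p 1 p _ - _).
(* This first coordinate makes the completed square vanish, leaving the form of the Schur complement
   alone. *)
move=> t t0; have := pA (tcons (- schur_shift A t) t).
rewrite qform_schur ?gt_eqF// addNr expr0n mulr0 add0r; apply.
by move=> /tcons_eq0[_].
Qed.

End Schur.

Lemma posdef_det_gt0 {R : realType} {p : nat} (A : 'M[R]_p) : posdef A -> 0 < \det A.
Proof.
elim: p A => [A _|p IH A pA]; first by rewrite det_mx00.
have a0 := posdef_pivot_gt0 _ pA.
rewrite det_schur ?gt_eqF//; last by case: pA.
by rewrite mulr_gt0// IH//; exact: posdef_schur.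
Qed.

(** * Lebesgue measure on tuples: uniqueness and translation invariance *)

Section TupleMeasure.
Context {R : realType} {p : nat}.
Implicit Types (a b t : p.-tuple R).

Lemma measurable_tnth_comp (i : 'I_p) :
  measurable_fun [set: p.-tuple R] (fun t => tnth t i).
Proof. exact: measurable_tnth. Qed.

Lemma box_bigcap a b :
  box a b = \bigcap_(i in [set: 'I_p]) ((fun t => tnth t i) @^-1` `[tnth a i, tnth b i]).
Proof.
apply/seteqP; split=> t /= H.
  by move=> i _ /=; rewrite in_itv/=; exact: H.
by move=> i; have := H i I; rewrite /= in_itv.
Qed.

Lemma measurable_box a b : measurable (box a b).
Proof.
rewrite box_bigcap; apply: fin_bigcap_measurable => // i _.
by rewrite -[X in measurable X]setTI; exact: measurable_tnth_comp.
Qed.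

(** The empty set is added to obtain stability under intersection: disjoint boxes meet in it, and
    [is_lebesgue] prescribes volumes only for ordered corners. *)
Definition boxes : set (set (p.-tuple R)) :=
  [set A | A = set0 \/ exists a b, (forall i, tnth a i <= tnth b i) /\ A = box a b].

Lemma boxes_box a b : boxes (box a b).
Proof.
have [ab|nab] := pselect (forall i, tnth a i <= tnth b i).
  by right; exists a, b.
left; apply/seteqP; split => // t H; apply: nab => i.
by have /andP[/le_trans] := H i; exact.
Qed.

Lemma boxes_setI : setI_closed boxes.
Proof.
move=> A B [->|[a [b [_ ->]]]]; first by rewrite set0I; left.
move=> [->|[a' [b' [_ ->]]]]; first by rewrite setI0; left.
rewrite (_ : _ `&` _ = box [tuple Num.max (tnth a i) (tnth a' i) | i < p]
   [tuple Num.min (tnth b i) (tnth b' i) | i < p]); first exact: boxes_box.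
apply/seteqP; split=> t /=.
  move=> [H H'] i; rewrite !tnth_mktuple ge_max le_min.
  by have /andP[-> ->] := H i; have /andP[-> ->] := H' i.
move=> H; split=> i; have := H i; rewrite !tnth_mktuple ge_max le_min;
  by move=> /andP[/andP[? ?] /andP[? ?]]; apply/andP.
Qed.

Definition cube (r : R) : set (p.-tuple R) :=
  box [tuple - r | _ < p] [tuple r | _ < p].

Lemma bigcup_cube : \bigcup_n cube n%:R = [set: p.-tuple R].
Proof.
apply/seteqP; split=> // t _; exists (Num.trunc (\sum_(i < p) `|tnth t i|)).+1 => // i.
rewrite !tnth_mktuple -ler_norml; apply: le_trans (ltW (truncnS_gt _)).
by rewrite (bigD1 i)//= lerDl sumr_ge0.
Qed.

(** Coordinate maps are already measurable for the sigma-algebra of boxes: rays generate the Borel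
    sets of the line, and the preimage of a ray is a countable union of boxes. *)
Lemma measurable_boxes : @measurable _ (p.-tuple R) = <<s boxes >>.
Proof.
apply/seteqP; split; last first.
  apply: smallest_sub; first exact: sigma_algebra_measurable.
  move=> A [->|[a [b [_ ->]]]]; [exact: measurable0|exact: measurable_box].
apply: smallest_sub; first exact: smallest_sigma_algebra.
move=> A; rewrite -bigcup_seq => -[i _ [B mB <-]]; rewrite setTI.
pose F := image_set_system [set: p.-tuple R] (fun t => tnth t i) <<s boxes >>.
suff : F B by rewrite /F /image_set_system/= setTI.
suff H : (@RGenCInfty.G R).-sigma.-measurable `<=` F.
  by apply: H; rewrite -RGenCInfty.measurableE; exact: mB.
move=> {B mB}; apply: smallest_sub; first exact/sigma_algebra_image/smallest_sigma_algebra.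
move=> B [x ->]; rewrite /F /image_set_system/= setTI.
have -> : (fun t => tnth t i) @^-1` `[x, +oo[ = \bigcup_n
    box [tuple if j == i then x else - n%:R | j < p] [tuple n%:R | j < p].
  apply/seteqP; split=> t /=.
    rewrite in_itv/= andbT => xt.
    have /= [n _ nt] : (\bigcup_n cube n%:R) t by rewrite bigcup_cube.
    exists n => // j; have /andP[H H'] := nt j; rewrite !tnth_mktuple in H H' *.
    by rewrite H' andbT; case: eqP => [->|_].
  move=> [n _ /(_ i)]; rewrite !tnth_mktuple eqxx => /andP[xt _].
  by rewrite in_itv/= xt.
apply: sigma_algebra_bigcup => n; apply: sub_sigma_algebra; exact: boxes_box.
Qed.

(** Boxes form a generating pi-system, and cubes of finite measure exhaust the space. *)
Lemma is_lebesgue_unique (m1 m2 : {measure set (p.-tuple R) -> \bar R}) :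
  is_lebesgue m1 -> is_lebesgue m2 -> forall A, measurable A -> m1 A = m2 A.
Proof.
move=> h1 h2; apply: (measure_unique boxes (fun n => cube n%:R)).
- exact: measurable_boxes.
- exact: boxes_setI.
- by move=> n; exact: boxes_box.
- exact: bigcup_cube.
- move=> A [->|[a [b [ab ->]]]]; first by rewrite !measure0.
  by rewrite h1// h2.
- move=> n; rewrite h1 ?ltry// => i.
  by rewrite !tnth_mktuple -subr_ge0 opprK addr_ge0.
Qed.

Lemma is_lebesgue_sigma_finite (m : {measure set (p.-tuple R) -> \bar R}) :
  is_lebesgue m -> sigma_finite setT m.
Proof.
move=> h; exists (fun n => cube n%:R); first by rewrite bigcup_cube.
move=> n; split; first exact: measurable_box.
rewrite h ?ltry// => i.
by rewrite !tnth_mktuple -subr_ge0 opprK addr_ge0.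
Qed.

Lemma measurable_tadd t : measurable_fun setT (fun h : p.-tuple R => tadd h t).
Proof.
apply/measurable_fun_tnthP => i /=.
rewrite (_ : _ \o _ = fun h => tnth h i + tnth t i).
  by apply: measurable_funD => //; exact: measurable_tnth_comp.
by apply/funext => h /=; rewrite tnth_mktuple.
Qed.

Section translation.
Variable lam : {measure set (p.-tuple R) -> \bar R}.
Hypothesis lamL : is_lebesgue lam.
Variable t : p.-tuple R.

Definition translated := pushforward lam (fun h : p.-tuple R => tadd h t).

HB.instance Definition _ := Measure.copy translated
  (measure_function_pushforward__canonical__measure_function_Measure lam (measurable_tadd t)).

Lemma is_lebesgue_translated : is_lebesgue translated.
Proof.
move=> a b ab; rewrite /translated /pushforward.
transitivity (lam (box (tsub a t) (tsub b t))).
  congr (lam _); apply/seteqP; split=> h /= H i; have := H i;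
    by rewrite !tnth_mktuple lerBlDr lerBrDr.
rewrite lamL; last by move=> i; rewrite !tnth_mktuple lerD2r.
by congr EFin; apply: eq_bigr => i _; rewrite !tnth_mktuple; ring.
Qed.

(** The image of [lam] under the translation also gives boxes their volume, hence equals [lam]; what
    remains is integration against an image measure. *)
Lemma integral_translation (f : p.-tuple R -> \bar R) (D : set (p.-tuple R)) :
  measurable D -> measurable_fun D f -> (forall x, D x -> 0 <= f x)%E ->
  (\int[lam]_(x in D) f x =
   \int[lam]_(x in (fun h => tadd h t) @^-1` D) f (tadd x t))%E.
Proof.
move=> mD mf f0.
have <- := @ge0_integral_pushforward _ _ _ _ _ _ (measurable_tadd t) lam D f mD mf.
  apply: (eq_measure_integral translated) => A mA _.
  exact: is_lebesgue_unique is_lebesgue_translated A mA.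
by move=> y; rewrite inE => /f0.
Qed.

End translation.
End TupleMeasure.

(** * Compactness of cubes *)

Section CubeCompact.
Context {R : realType} {p : nat}.

(** Dividing by [p.+1] rather than by the square root of [p] is crude, but keeps the bound strict
    and the denominator nonzero in dimension 0. *)
Lemma enorm_lt (h : p.-tuple R) (r : R) : 0 < r ->
  (forall i, `|tnth h i| < r / p.+1%:R) -> enorm h < r.
Proof.
move=> r0 H; rewrite -[ltRHS]ger0_norm ?ltW// -sqrtr_sqr ltr_sqrt ?exprn_gt0//.
have p0 : 0 < p.+1%:R :> R by rewrite ltr0n.
apply: (@le_lt_trans _ _ (\sum_(i < p) (r / p.+1%:R) ^+ 2)).
  apply: ler_sum => i _; rewrite -real_normK ?num_real//.
  by rewrite ler_sqr ?nnegrE//; [exact/ltW | rewrite divr_ge0// ltW].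
rewrite sumr_const card_ord -[ltLHS]mulr_natr expr_div_n -mulrA gtr_pMr ?exprn_gt0//.
rewrite mulrC ltr_pdivrMr ?exprn_gt0// mul1r -natrX ltr_nat.
by rewrite expnS expn1 mulSn ltn_addr.
Qed.

(** Compactness is imported from products of segments in row vectors; there balls are taken for the
    maximum norm, and [enorm_lt] compares them with Euclidean balls. *)
Lemma tcompact_cube (r : R) : tcompact (cube r : set (p.-tuple R)).
Proof.
move=> I U Uop cov.
pose tof (v : 'rV[R]_p) : p.-tuple R := [tuple v ord0 i | i < p].
have cK : compact [set v : 'rV[R]_p | forall i, `[- r, r]%classic (v ord0 i)].
  by apply: (@rV_compact R p (fun=> `[- r, r]%classic)) => i; exact: segment_compact.
move: cK; rewrite compact_cover.
move=> /(_ {classic I} setT (fun i => tof @^-1` U i)) [].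
- move=> i _; rewrite openE => v /= Uv; rewrite /interior.
  have [e e0 He] := Uop i _ Uv.
  apply/nbhs_ballP; exists (e / p.+1%:R); first by rewrite /= divr_gt0.
  move=> w vw; apply: He; apply: enorm_lt => // j.
  by have := vw; rewrite /ball/= /mx_ball => -[_ /(_ ord0 j)]; rewrite /ball/= !tnth_mktuple distrC.
- move=> v /= H; have [|i _ Ui] := cov (tof v).
    by move=> i; have := H i; rewrite /= in_itv/= !tnth_mktuple.
  by exists i.
- move=> D _ covD; exists (size (finmap.enum_fset D)).
  exists (tnth (in_tuple (finmap.enum_fset D))) => t Kt.
  have [|i Di Ui] := covD (trow t).
    by move=> i /=; rewrite in_itv/= mxE; have := Kt i; rewrite !tnth_mktuple.
  have tofK : tof (trow t) = t.
    by apply: eq_from_tnth => j; rewrite tnth_mktuple mxE.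
  have /tnthP[k ik] : i \in in_tuple (finmap.enum_fset D) by [].
  by exists k => //; rewrite -ik; move: Ui; rewrite /preimage/= tofK.
Qed.

End CubeCompact.

(** * Lebesgue measure in one more dimension *)

Lemma tnth_behead_lift {T : Type} {p : nat} (a : p.+1.-tuple T) (i : 'I_p) :
  tnth [tuple of behead a] i = tnth a (lift ord0 i).
Proof. by rewrite [in RHS](tuple_eta a) tnthS. Qed.

Section LebesgueSucc.
Context {R : realType} {p : nat}.
Variable m : {sigma_finite_measure set (p.-tuple R) -> \bar R}.

Definition tcons_pair (z : measurableTypeR R * p.-tuple R) : p.+1.-tuple R := tcons z.1 z.2.

Lemma measurable_tcons_pair : measurable_fun setT tcons_pair.
Proof. exact: (@measurable_cons _ _ _ _ fst _ snd). Qed.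

Definition lebesgue_succ := pushforward (@lebesgue_measure R \x m)%E tcons_pair.

HB.instance Definition _ := Measure.copy lebesgue_succ
  (measure_function_pushforward__canonical__measure_function_Measure
     (@lebesgue_measure R \x m)%E measurable_tcons_pair).

Lemma is_lebesgue_succ : is_lebesgue m -> is_lebesgue lebesgue_succ.
Proof.
move=> mL a b ab.
transitivity ((@lebesgue_measure R \x m)%E (`[thead a, thead b] `*`
    box [tuple of behead a] [tuple of behead b])).
  congr ((_ \x _)%E _); apply/seteqP; split => -[x t] /=.
    move=> H; split; first by rewrite in_itv/=; exact: (H ord0).
    by move=> i; have := H (lift ord0 i); rewrite tnthS !tnth_behead_lift.
  rewrite in_itv/= => -[H0 H] i.
  have [->|i0] := eqVneq i ord0; first by rewrite -[tnth a _]/(thead a).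
  have [j ->] : exists j, i = lift ord0 j.
    by case: (unliftP ord0 i) i0 => [j ->|->]; [exists j|rewrite eqxx].
  by rewrite tnthS -!tnth_behead_lift.
rewrite product_measure1E//; last exact: measurable_box.
rewrite mL; last first.
  by move=> i; rewrite !tnth_behead_lift.
rewrite [X in (X * _)%E](lebesgue_measure_itv `[thead a, thead b])/= lte_fin big_ord_recl.
(* The length of an interval is defined by cases on the strict order of its ends, so a degenerate
   first side is treated apart; both volumes are then 0. *)
have := ab ord0; rewrite le_eqVlt -![tnth _ ord0]/(thead _) => /orP[/eqP e|->]; last first.
  rewrite -EFinB -EFinM; congr (_ * _)%:E; apply: eq_bigr => i _.
  by rewrite !tnth_behead_lift.
by rewrite e ltxx mul0e subrr mul0r.
Qed.

Lemma integral_lebesgue_succ (f : p.+1.-tuple R -> \bar R) :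
  measurable_fun setT f -> (forall h, 0 <= f h)%E ->
  (\int[lebesgue_succ]_h f h =
   \int[(@lebesgue_measure R \x m)]_z f (tcons_pair z))%E.
Proof.
move=> mf f0; have := @ge0_integral_pushforward _ _ _ _ _ _ measurable_tcons_pair
  (@lebesgue_measure R \x m)%E setT f measurableT mf.
by rewrite preimage_setT; apply => h _.
Qed.

End LebesgueSucc.

(** * Gaussian integrals in dimension [p] *)

Section GaussianIntegral.
Context {R : realType}.

Lemma measurable_qform p (A : 'M[R]_p) (m : p.-tuple R) :
  measurable_fun setT (fun t : p.-tuple R => qform A (tsub t m)).
Proof.
under eq_fun do rewrite /qform bform_sum.
apply: measurable_sum => i; apply: measurable_sum => j.
have mt k : measurable_fun setT (fun x : p.-tuple R => tnth (tsub x m) k).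
  under eq_fun do rewrite tnth_mktuple.
  by apply: measurable_funB => //; exact: measurable_tnth_comp.
by apply: measurable_funM => //; apply: measurable_funM.
Qed.

Definition gauss_kernel {p} (A : 'M[R]_p) (m t : p.-tuple R) : R :=
  expR (- (1 / 2) * qform A (tsub t m)).

Lemma measurable_gauss_kernel {p} (A : 'M[R]_p) (m : p.-tuple R) :
  measurable_fun setT (gauss_kernel A m).
Proof.
apply: measurableT_comp => //; apply: measurable_funM => //.
exact: measurable_qform.
Qed.

(** The integrand is the normal density of mean [- s] and standard deviation [(Num.sqrt a)^-1],
    divided by its peak value. *)
Lemma integral_gauss_kernel1 (a s : R) : 0 < a ->
  (\int[lebesgue_measure]_(x in [set: R]) (expR (- (1 / 2) * (a * (x + s) ^+ 2)))%:E =
   (Num.sqrt (2 * pi / a))%:E)%E.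
Proof.
move=> a0; have sa : (Num.sqrt a)^-1 != 0 by rewrite invr_neq0// sqrtr_eq0 -ltNge.
have pk := normal_peak_gt0 sa.
transitivity (\int[lebesgue_measure]_(x in [set: R])
    ((normal_peak (Num.sqrt a)^-1)^-1%:E * (normal_pdf (- s) (Num.sqrt a)^-1 x)%:E))%E.
  apply: eq_integral => x _; rewrite -EFinM normal_pdfE// mulKf ?gt_eqF//.
  congr (expR _)%:E; rewrite opprK exprVn sqr_sqrtr ?ltW//.
  by field; rewrite gt_eqF.
rewrite ge0_integralZl//; first last.
- by rewrite lee_fin invr_ge0 normal_peak_ge0.
- by move=> x _; rewrite lee_fin normal_pdf_ge0.
- apply/measurable_EFinP; exact: measurable_normal_pdf.
rewrite integral_normal_pdf mule1; congr EFin.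
rewrite /normal_peak invrK exprVn sqr_sqrtr ?ltW//; congr Num.sqrt.
by field; rewrite gt_eqF.
Qed.

(** Measure and integral are built together by induction: Tonelli integrates the first coordinate
    out, the Schur complement governs the others, and [det_schur] multiplies the constants. The
    model carries the sigma-finiteness that Tonelli requires, and later serves for measurability in
    the sample point. *)
Lemma exists_lebesgue_gauss p :
  exists2 m : {sigma_finite_measure set (p.-tuple R) -> \bar R}, is_lebesgue m &
  forall A : 'M[R]_p, posdef A ->
  (\int[m]_t (expR (- (1 / 2) * qform A t))%:E =
   (Num.sqrt ((2 * pi) ^+ p / \det A))%:E)%E.
Proof.
elim: p => [|p [m mL IH]].
  (* In dimension 0 the space is one point and the volume of a box is the empty product. *)
  exists (@dirac _ _ (@tzero R 0) R).
    by move=> a b _; rewrite big_ord0 [LHS]diracE mem_set// => -[].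
  move=> A _.
  rewrite /= integral_dirac//; last first.
    rewrite (_ : (fun _ => _) = cst 1%:E)//; apply/funext => t.
    by rewrite /qform bform_sum big_ord0 mulr0 expR0.
  rewrite diracT mul1e /qform /bform det_mx00.
  by rewrite expr0 divr1 sqrtr1 mxE big_ord0 mulr0 expR0.
pose m' : {sigma_finite_measure set (p.+1.-tuple R) -> \bar R} :=
  HB.pack (lebesgue_succ m) (Measure_isSigmaFinite.Build _ _ _ (lebesgue_succ m)
    (is_lebesgue_sigma_finite _ (is_lebesgue_succ m mL))).
exists m'; first exact: is_lebesgue_succ.
move=> A pA.
have a0 := posdef_pivot_gt0 _ pA; have sA : A^T = A by case: pA.
have pS := posdef_schur _ pA.
have d0 := posdef_det_gt0 _ pS.
pose f (h : p.+1.-tuple R) := (expR (- (1 / 2) * qform A h))%:E.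
have mq : forall q (B : 'M[R]_q), measurable_fun setT (fun t : q.-tuple R => qform B t).
  move=> q B; have := measurable_qform _ B tzero; congr measurable_fun.
  apply/funext => t; congr qform; apply: trow_inj; by rewrite !trowE subr0.
have mf : measurable_fun setT f.
  apply/measurable_EFinP; apply: measurableT_comp => //.
  by apply: measurable_funM => //; exact: mq.
transitivity (\int[(@lebesgue_measure R \x m)%E]_z f (tcons_pair z))%E.
  apply: (integral_lebesgue_succ m f mf) => h.
  by rewrite lee_fin expR_ge0.
rewrite fubini_tonelli2; first last.
- by move=> z; rewrite lee_fin expR_ge0.
- apply: measurableT_comp => //; exact: measurable_tcons_pair.
rewrite /fubini_G.
transitivity (\int[m]_t ((Num.sqrt (2 * pi / pivot A))%:E *
    (expR (- (1 / 2) * qform (schur A) t))%:E))%E.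
  apply: eq_integral => t _.
  transitivity (\int[lebesgue_measure]_(x in [set: R])
     ((expR (- (1 / 2) * qform (schur A) t))%:E *
      (expR (- (1 / 2) * (pivot A * (x + schur_shift A t) ^+ 2)))%:E))%E.
    apply: eq_integral => x _; rewrite /f/= qform_schur ?gt_eqF//.
    by rewrite -EFinM -expRD -mulrDr addrC.
  rewrite ge0_integralZl//; first by rewrite integral_gauss_kernel1// muleC.
  - apply/measurable_EFinP; apply: measurableT_comp => //.
    apply: measurable_funM => //; apply: measurable_funM => //.
    by apply: measurable_funX; apply: measurable_funD.
rewrite ge0_integralZl//; last first.
  apply/measurable_EFinP; apply: measurableT_comp => //.
  by apply: measurable_funM => //; exact: mq.
rewrite IH// -EFinM -sqrtrM ?divr_ge0 ?mulr_ge0 ?pi_ge0 ?(ltW a0)//.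
congr (Num.sqrt _)%:E; rewrite det_schur ?gt_eqF// exprS.
by field; rewrite !gt_eqF.
Qed.

(** Translation removes [m], and uniqueness carries the value from the model to [lam]. *)
Lemma integral_gauss_kernel p (lam : {measure set (p.-tuple R) -> \bar R})
    (A : 'M[R]_p) (m : p.-tuple R) : is_lebesgue lam -> posdef A ->
  (\int[lam]_t (gauss_kernel A m t)%:E =
   (Num.sqrt ((2 * pi) ^+ p / \det A))%:E)%E.
Proof.
move=> lamL pA; have [l lL <-//] := exists_lebesgue_gauss p.
rewrite (integral_translation _ lamL m) ?preimage_setT//; first last.
- by move=> x _; rewrite lee_fin expR_ge0.
- by apply/measurable_EFinP; exact: measurable_gauss_kernel.
transitivity (\int[lam]_t (expR (- (1 / 2) * qform A t))%:E)%E.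
  apply: eq_integral => t _; congr (expR (_ * qform _ _))%:E.
  by apply: trow_inj; rewrite !trowE addrK.
apply: eq_measure_integral => B mB _.
exact: is_lebesgue_unique.
Qed.

End GaussianIntegral.

(** * Masses of densities and total variation *)

Section Density.
Context d (T : measurableType d) (R : realType).
Variable lam : {measure set T -> \bar R}.
Implicit Types (f g : T -> R) (A B : set T) (k C e : R).

Definition is_density f := [/\ measurable_fun setT f, forall t, 0 <= f t &
  (\int[lam]_t (f t)%:E = 1)%E].

(** Real-valued, so that comparisons become real arithmetic; for a density [fine] loses nothing, all
    masses being at most 1. *)
Definition dmass f A : R := fine (\int[lam]_(x in A) (f x)%:E)%E.

Section one_density.
Variable f : T -> R.
Hypothesis df : is_density f.

Let mf A : measurable_fun A (EFin \o f).
Proof. by apply/measurable_EFinP; case: df => mf _ _; exact: measurable_funTS. Qed.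

Let f0 t : 0 <= f t. Proof. by case: df. Qed.

Lemma integral_density_le1 A : measurable A -> (\int[lam]_(x in A) (f x)%:E <= 1)%E.
Proof.
move=> mA; case: df => _ _ <-; apply: ge0_subset_integral => //.
by move=> t _; rewrite lee_fin.
Qed.

Lemma dmassE A : measurable A -> (\int[lam]_(x in A) (f x)%:E = (dmass f A)%:E)%E.
Proof.
move=> mA; rewrite /dmass fineK// ge0_fin_numE; last first.
  by apply: integral_ge0 => t _; rewrite lee_fin.
by rewrite (le_lt_trans (integral_density_le1 _ mA))// ltry.
Qed.

Lemma dmass_ge0 A : 0 <= dmass f A.
Proof. by apply: fine_ge0; apply: integral_ge0 => t _; rewrite lee_fin. Qed.

Lemma dmass_le1 A : measurable A -> dmass f A <= 1.
Proof. by move=> mA; rewrite -lee_fin -dmassE//; exact: integral_density_le1. Qed.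

Lemma dmassT : dmass f setT = 1.
Proof. by rewrite /dmass; case: df => _ _ ->. Qed.

Lemma dmass_le A B : measurable A -> measurable B -> A `<=` B ->
  dmass f A <= dmass f B.
Proof.
move=> mA mB AB; rewrite -lee_fin -!dmassE//; apply: ge0_subset_integral => //.
by move=> t _; rewrite lee_fin.
Qed.

Lemma dmass_setID A B : measurable A -> measurable B ->
  dmass f A = dmass f (A `&` B) + dmass f (A `\` B).
Proof.
move=> mA mB; apply: EFin_inj; rewrite EFinD -!dmassE//; last 2 first.
  - exact: measurableD.
  - exact: measurableI.
rewrite -[in LHS](setUIDK A B) ge0_integral_setU//.
- exact: measurableI.
- exact: measurableD.
- by move=> t _; rewrite lee_fin.
- by apply/disj_setPS => t [[_ Bt] [_ nBt]].
Qed.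

Lemma dmass_setC A : measurable A -> dmass f A = 1 - dmass f (~` A).
Proof.
move=> mA; rewrite -dmassT (dmass_setID setT A)// setTI setTD.
by rewrite addrK.
Qed.

End one_density.

Lemma dmass_le_scale f g A k : is_density f -> is_density g -> measurable A -> 0 <= k ->
  (forall t, A t -> f t <= k * g t) -> dmass f A <= k * dmass g A.
Proof.
move=> df dg mA k0 H; have [mf f0 _] := df; have [mg g0 _] := dg.
rewrite -lee_fin EFinM -!dmassE// -ge0_integralZl//; last 2 first.
  - by apply/measurable_EFinP; exact: measurable_funTS.
  - by move=> t _; rewrite lee_fin.
apply: ge0_le_integral => //.
- by move=> t _; rewrite lee_fin.
- by apply/measurable_EFinP; exact: measurable_funTS.
- by apply/measurable_EFinP; apply: measurable_funM => //; exact: measurable_funTS.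
Qed.

Lemma scale_le_dmass f g A k : is_density f -> is_density g -> measurable A -> 0 <= k ->
  (forall t, A t -> k * g t <= f t) -> k * dmass g A <= dmass f A.
Proof.
move=> df dg mA; rewrite le_eqVlt => /predU1P[<- _|k0 H].
  by rewrite mul0r dmass_ge0.
rewrite mulrC -ler_pdivlMr// mulrC; apply: dmass_le_scale => //.
  by rewrite invr_ge0 ltW.
by move=> t At; rewrite mulrC ler_pdivlMr// mulrC H.
Qed.

(** The factor [C] is not known in advance. Comparing the masses of [B], both in [[1 - e, 1]], gives
    [C * (1 + e) <= 1 + 6 * e] and [C * (1 - e) >= 1 - 6 * e]. The parts of [A] inside [B] thus
    differ by at most [6 * e], and the parts outside by at most [e]. *)
Lemma dmass_close f g B C e : is_density f -> is_density g -> measurable B ->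
  0 <= C -> 0 <= e <= 1 / 4 ->
  (forall t, B t -> C * (1 - e) * g t <= f t <= C * (1 + e) * g t) ->
  dmass f (~` B) <= e -> dmass g (~` B) <= e ->
  forall A, measurable A -> `|dmass f A - dmass g A| <= 7 * e.
Proof.
move=> df dg mB C0 /andP[e0 e4] fg fB gB A mA.
have Cl : 0 <= C * (1 - e) by rewrite mulr_ge0//; lra.
have Cu : 0 <= C * (1 + e) by rewrite mulr_ge0//; lra.
have mAB : measurable (A `&` B) by exact: measurableI.
have mAD : measurable (A `\` B) by exact: measurableD.
have mcB := measurableC mB.
have lo D : measurable D -> D `<=` B -> C * (1 - e) * dmass g D <= dmass f D.
  by move=> mD DB; apply: scale_le_dmass => // t /DB /fg /andP[].
have up D : measurable D -> D `<=` B -> dmass f D <= C * (1 + e) * dmass g D.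
  by move=> mD DB; apply: dmass_le_scale => // t /DB /fg /andP[].
have := lo B mB (@subset_refl _ B); have := up B mB (@subset_refl _ B).
have := lo _ mAB (@subIsetr _ A B); have := up _ mAB (@subIsetr _ A B).
have := dmass_setC _ df _ mB; have := dmass_setC _ dg _ mB.
have := dmass_setID _ df _ _ mA mB; have := dmass_setID _ dg _ _ mA mB.
have := dmass_ge0 _ df (A `\` B); have := dmass_ge0 _ dg (A `\` B).
have sub : A `\` B `<=` ~` B by move=> t [].
have := dmass_le _ df _ _ mAD mcB sub; have := dmass_le _ dg _ _ mAD mcB sub.
have := dmass_ge0 _ dg (A `&` B); have := dmass_le1 _ dg _ mAB.
have := dmass_le1 _ df _ mB; have := dmass_le1 _ dg _ mB.
move: fB gB.
move: (dmass f A) (dmass g A) (dmass f (A `&` B)) (dmass g (A `&` B)).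
move: (dmass f (A `\` B)) (dmass g (A `\` B)) (dmass f B) (dmass g B).
move: (dmass f (~` B)) (dmass g (~` B)).
move=> fc gc fD gD fB gB fA gA x y hfc hgc g1 f1 y1 y0 hg hf gD0 fD0 -> -> hgB hfB.
move=> xu xl Bu Bl.
have C1 : C * (1 + e) <= 1 + 6 * e.
  have : C * (1 - e) * (1 - e) <= 1.
    by apply: le_trans f1; apply: le_trans Bl; apply: ler_wpM2l => //; lra.
  by move: e0 e4; clear; nra.
have C2 : 1 - 6 * e <= C * (1 - e).
  have : 1 - e <= C * (1 + e).
    have : C * (1 + e) * gB <= C * (1 + e) * 1 by apply: ler_wpM2l.
    lra.
  by move: e0 e4; clear; nra.
have x1 : x <= y + 6 * e.
  apply: le_trans xu _; have : C * (1 + e) * y <= (1 + 6 * e) * y by apply: ler_wpM2r.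
  have : e * y <= e * 1 by apply: ler_wpM2l.
  lra.
have x2 : y - 6 * e <= x.
  apply: le_trans _ xl; have : (1 - 6 * e) * y <= C * (1 - e) * y by apply: ler_wpM2r.
  have : e * y <= e * 1 by apply: ler_wpM2l.
  lra.
rewrite ler_norml; apply/andP; split; lra.
Qed.

End Density.
Arguments dmassE {d T R lam f}.
Arguments dmass_ge0 {d T R lam f}.
Arguments dmass_le1 {d T R lam f}.
Arguments dmass_le {d T R lam f}.
Arguments dmass_setC {d T R lam f}.
Arguments dmass_setID {d T R lam f}.
Arguments dmass_le_scale {d T R lam f g}.
Arguments scale_le_dmass {d T R lam f g}.
Arguments dmass_close {d T R lam f g B C e}.
Arguments is_density {d T R}.
Arguments dmass {d T R}.

Lemma dTV_le (R : realType) (p : nat) (lam : {measure set (p.-tuple R) -> \bar R})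
    (f g : p.-tuple R -> R) (e : R) : is_density lam f -> is_density lam g ->
  (forall A, measurable A -> `|dmass lam f A - dmass lam g A| <= e) ->
  (dTV lam f g <= e%:E)%E.
Proof.
move=> df dg H; apply: ge_ereal_sup => _ [A mA <-].
by rewrite !dmassE// -EFinB abse_EFin lee_fin H.
Qed.

(** * Tails of a normal density with a small mass in an annulus *)

Section GaussianTail.
Context {R : realType} {p : nat}.
Variable lam : {measure set (p.-tuple R) -> \bar R}.
Hypothesis lamL : is_lebesgue lam.
Variable V : 'M[R]_p.
Hypothesis Vpos : posdef V.

Let sV : V^T = V. Proof. by case: Vpos. Qed.

Lemma posdef_scale (c : R) : 0 < c -> posdef (c *: V).
Proof.
move=> c0; split; first by rewrite linearZ/= sV.
by move=> h h0; rewrite qformZm mulr_gt0//; case: Vpos => _; exact.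
Qed.

(** The precision matrix of this covariance is [c *: V]; real powers become square roots, so that
    the constant is visibly the inverse of the Gaussian integral. *)
Lemma gauss_densityE (c : R) (m t : p.-tuple R) : 0 < c ->
  gauss_density m (c^-1 *: invmx V) t =
  (Num.sqrt ((2 * pi) ^+ p / \det (c *: V)))^-1 * gauss_kernel (c *: V) m t.
Proof.
move=> c0; have uV := posdef_unitmx _ Vpos.
have ucV := posdef_unitmx _ (posdef_scale c c0).
have dcV := posdef_det_gt0 _ (posdef_scale c c0).
rewrite /gauss_density -invmxZ// invmxK det_inv /gauss_kernel; congr (_ * _).
have pi2 : 0 <= 2 * pi :> R by rewrite mulr_ge0// pi_ge0.
rewrite powRN.
have -> : - (1 / 2) = - 2^-1 :> R by rewrite mul1r.
have -> : (\det (c *: V))^-1 `^ (- 2^-1) = Num.sqrt (\det (c *: V)).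
  by rewrite powRN powR12_sqrt ?invr_ge0 ?ltW// sqrtrV ?ltW// invrK.
have -> : (2 * pi) `^ (p%:R / 2) = Num.sqrt ((2 * pi : R) ^+ p).
  by rewrite powRrM powR_mulrn// powR12_sqrt// exprn_ge0.
by rewrite sqrtrM ?exprn_ge0// sqrtrV ?ltW// invfM invrK.
Qed.

Lemma gauss_kernel_gt0 (A : 'M[R]_p) m t : 0 < gauss_kernel A m t.
Proof. exact: expR_gt0. Qed.

Lemma gauss_norm_gt0 (c : R) : 0 < c -> 0 < Num.sqrt ((2 * pi) ^+ p / \det (c *: V)).
Proof.
move=> c0; rewrite sqrtr_gt0 divr_gt0 ?exprn_gt0 ?mulr_gt0 ?pi_gt0//.
exact: posdef_det_gt0 (posdef_scale _ c0).
Qed.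

Lemma is_density_gauss (c : R) m : 0 < c ->
  is_density lam (gauss_density m (c^-1 *: invmx V)).
Proof.
move=> c0; have Z0 := gauss_norm_gt0 c c0.
have -> : gauss_density m (c^-1 *: invmx V) = fun t =>
    (Num.sqrt ((2 * pi) ^+ p / \det (c *: V)))^-1 * gauss_kernel (c *: V) m t.
  by apply/funext => t; exact: gauss_densityE.
split.
- by apply: measurable_funM => //; exact: measurable_gauss_kernel.
- by move=> t; rewrite mulr_ge0 ?ltW ?invr_gt0// ?gauss_kernel_gt0.
- under eq_integral do rewrite EFinM.
  rewrite ge0_integralZl//.
  + rewrite integral_gauss_kernel//; last exact: posdef_scale.
    by rewrite -EFinM mulVf ?gt_eqF.
  + by apply/measurable_EFinP; exact: measurable_gauss_kernel.
  + by move=> t _; rewrite lee_fin ltW// gauss_kernel_gt0.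
Qed.

Definition qball (t0 : p.-tuple R) (r : R) : set (p.-tuple R) :=
  [set t | qnorm V (tsub t t0) <= r].

Lemma measurable_qnorm t0 : measurable_fun setT (fun t => qnorm V (tsub t t0)).
Proof.
exact: (measurableT_comp (continuous_measurable_fun (@sqrt_continuous R))
  (measurable_qform _ V t0)).
Qed.

Lemma measurable_qball t0 r : measurable (qball t0 r).
Proof.
have -> : qball t0 r = (fun t => qnorm V (tsub t t0)) @^-1` `]-oo, r].
  by apply/seteqP; split => t /=; rewrite in_itv.
by rewrite -[X in measurable X]setTI; exact: measurable_qnorm.
Qed.

Lemma le_qball t0 r r' : r <= r' -> qball t0 r `<=` qball t0 r'.
Proof. by move=> rr t /= /le_trans; exact. Qed.

Variables (c : R) (m t0 : p.-tuple R) (g : p.-tuple R -> R) (Z : R).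
Hypothesis c0 : 0 < c.
Hypothesis ZE : Z = Num.sqrt ((2 * pi) ^+ p / \det (c *: V)).
Hypothesis gE : forall t, g t = Z^-1 * gauss_kernel (c *: V) m t.
Hypothesis dg : is_density lam g.

Let Z0 : 0 < Z. Proof. by rewrite ZE gauss_norm_gt0. Qed.

Let g_ge0 t : 0 <= g t. Proof. by case: dg. Qed.

Let mg : measurable_fun setT g. Proof. by case: dg. Qed.

(** By the triangle inequality the translated ball stays at distances between [2 * r] and [4 * r]
    from [t0]. *)
Lemma qball_translate_sub (v : p.-tuple R) (r : R) : 0 < r -> qnorm V v = 3 * r ->
  (fun t => tadd t v) @` qball t0 r `<=` qball t0 (7 * r) `\` qball t0 r.
Proof.
move=> r0 vr _ [t Bt <-]; rewrite /qball/= in Bt *.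
have e : tsub (tadd t v) t0 = tadd (tsub t t0) v.
  by apply: trow_inj; rewrite !trowE addrAC.
split; rewrite e.
  by apply: le_trans (qnormD _ Vpos _ _) _; rewrite vr; lra.
apply/negP; rewrite -ltNge.
have := qnorm_ge_sub _ Vpos v (tscale (-1) (tsub t t0)).
rewrite qnormZ normrN1 mul1r.
have -> : tsub v (tscale (-1) (tsub t t0)) = tadd (tsub t t0) v.
  by apply: trow_inj; rewrite !trowE scaleN1r opprK addrC.
rewrite vr; lra.
Qed.

(** By translation invariance the left side is the mass of the ball of radius [r] around
    [tadd t0 v], which lies in the annulus. *)
Lemma dmass_translate (v : p.-tuple R) (r : R) : 0 < r -> qnorm V v = 3 * r ->
  (\int[lam]_(x in qball t0 r) (g (tadd x v))%:E <=
   (dmass lam g (qball t0 (7 * r) `\` qball t0 r))%:E)%E.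
Proof.
move=> r0 vr.
have mS : measurable (qball t0 (7 * r) `\` qball t0 r).
  by apply: measurableD; exact: measurable_qball.
have mB : measurable (qball (tadd t0 v) r) by exact: measurable_qball.
have eB : qball t0 r = (fun t => tadd t v) @^-1` qball (tadd t0 v) r.
  apply/funext => t; rewrite /qball/=; congr (qnorm _ _ <= _).
  by apply: trow_inj; rewrite !trowE opprD addrACA subrr addr0.
rewrite -(dmassE dg)// [in X in (X <= _)%E]eB -(integral_translation _ lamL v (EFin \o g))//; first last.
- by move=> x _; rewrite lee_fin.
- by apply/measurable_EFinP; exact: measurable_funTS.
apply: ge0_subset_integral => //.
- by apply/measurable_EFinP; exact: measurable_funTS.
- by move=> x _; rewrite lee_fin.
- move=> x Bx; apply: (qball_translate_sub v r r0 vr); exists (tsub x v).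
    by rewrite eB/= (_ : tadd (tsub x v) v = x)//; apply: trow_inj; rewrite !trowE subrK.
  by apply: trow_inj; rewrite !trowE subrK.
Qed.

Section annulus.
Variables (r e : R).
Hypothesis r0 : 0 < r.
Hypothesis e1 : e < 1.
Hypothesis gB_gt0 : 0 < dmass lam g (qball t0 r).
Hypothesis annulus_small :
  dmass lam g (qball t0 (7 * r) `\` qball t0 r) <= e * dmass lam g (qball t0 r).

Let mB : measurable (qball t0 r). Proof. exact: measurable_qball. Qed.

Let mgv v : measurable_fun setT (fun t => g (tadd t v)).
Proof. by apply: measurableT_comp => //; exact: measurable_tadd. Qed.

Let tscaleN v : qnorm V (tscale (-1) v) = qnorm V v.
Proof. by rewrite qnormZ normrN1 mul1r. Qed.

(* [g (t + v) * g (t - v) = g t ^ 2 * expR (- c * qform V v)], so by AM-GM the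
   translates of the ball by [v] and [- v], which lie in the annulus, carry at
   least the mass of the ball times [expR (- c * qform V v / 2)]. *)
Lemma annulus_precision : (0 < p)%N -> expR (- (9 / 2) * c * r ^+ 2) <= e.
Proof.
(* A direction exists because [p] is positive; it is then rescaled to norm [3 * r]. *)
move=> p0; pose u : p.-tuple R := [tuple 1 | _ < p].
have u0 : 0 < qnorm V u.
  rewrite sqrtr_gt0; case: Vpos => _; apply => eu.
  have := congr1 (fun h => tnth h (Ordinal p0)) eu.
  by rewrite !tnth_mktuple => /eqP; rewrite oner_eq0.
pose v := tscale (3 * r / qnorm V u) u.
have vr : qnorm V v = 3 * r.
  rewrite qnormZ gtr0_norm ?divfK ?gt_eqF//.
  by rewrite divr_gt0// mulr_gt0.
have nvr : qnorm V (tscale (-1) v) = 3 * r by rewrite tscaleN.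
have qv : qform V v = 9 * r ^+ 2 by rewrite -sqr_qnorm// vr; ring.
set k := expR _.
have k0 : 0 < k := expR_gt0 _.
have pt t : k * g t <= 1 / 2 * (g (tadd t v) + g (tadd t (tscale (-1) v))).
  rewrite !gE /gauss_kernel !qformZm.
  set q := qform V (tsub t m); set b := bform V (tsub t m) v.
  have q1 : qform V (tsub (tadd t v) m) = q + 2 * b + 9 * r ^+ 2.
    rewrite -qv -qformD//; congr qform.
    by apply: trow_inj; rewrite !trowE addrAC.
  have q2 : qform V (tsub (tadd t (tscale (-1) v)) m) = q - 2 * b + 9 * r ^+ 2.
    rewrite -qv -qformB//; congr qform.
    by apply: trow_inj; rewrite !trowE scaleN1r addrAC.
  rewrite q1 q2 -mulrDr mulrCA [1 / 2 * _]mulrCA ler_pM2l ?invr_gt0//.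
  rewrite /k -expRD.
  set x := - (9 / 2) * c * r ^+ 2 + - (1 / 2) * (c * q).
  have -> : - (1 / 2) * (c * (q + 2 * b + 9 * r ^+ 2)) = x - c * b by rewrite /x; field.
  have -> : - (1 / 2) * (c * (q - 2 * b + 9 * r ^+ 2)) = x + c * b by rewrite /x; field.
  clearbody x; rewrite !expRD -mulrDr mulrCA -[leLHS]mulr1 ler_pM2l ?expR_gt0//.
  (* The two exponentials have product 1, so their sum is at least 2. *)
  have h1 : expR (- (c * b)) * expR (c * b) = 1 by rewrite -expRD addNr expR0.
  have h2 := expR_gt0 (- (c * b)); have h3 := expR_gt0 (c * b).
  have h4 := sqr_ge0 (expR (- (c * b)) - expR (c * b)).
  move: h1 h2 h3 h4; move: (expR _) (expR _) => y z; nra.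
have main : (k%:E * (dmass lam g (qball t0 r))%:E <=
    (1 / 2)%:E * ((dmass lam g (qball t0 (7 * r) `\` qball t0 r))%:E +
     (dmass lam g (qball t0 (7 * r) `\` qball t0 r))%:E))%E.
  rewrite -(dmassE dg)// -ge0_integralZl//; first last.
  - by rewrite lee_fin ltW.
  - by move=> x _; rewrite lee_fin.
  - by apply/measurable_EFinP; exact: measurable_funTS.
  apply: (@le_trans _ _ (\int[lam]_(x in qball t0 r) ((1 / 2)%:E *
     ((g (tadd x v))%:E + (g (tadd x (tscale (-1) v)))%:E)))%E).
    apply: ge0_le_integral => //.
    + by move=> x _; rewrite mule_ge0 ?lee_fin// ltW.
    + apply/measurable_EFinP; apply: measurable_funM => //; exact: measurable_funTS.
    + apply/measurable_EFinP; apply: measurable_funM => //.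
      by apply: measurable_funD; exact: measurable_funTS.
    + by move=> x _; rewrite -EFinD -!EFinM lee_fin.
  rewrite ge0_integralZl//; first last.
  - by move=> x _; rewrite -EFinD lee_fin addr_ge0.
  - apply/measurable_EFinP.
    by apply: measurable_funD; exact: measurable_funTS.
  apply: lee_wpmul2l; first by rewrite lee_fin.
  rewrite ge0_integralD//; first last.
  - by apply/measurable_EFinP; exact: measurable_funTS.
  - by move=> x _; rewrite lee_fin.
  - by apply/measurable_EFinP; exact: measurable_funTS.
  - by move=> x _; rewrite lee_fin.
  by apply: leeD; exact: dmass_translate.
move: main; rewrite -EFinD -!EFinM lee_fin => main.
have {}main : k * dmass lam g (qball t0 r) <= e * dmass lam g (qball t0 r).
  by apply: le_trans main _; apply: le_trans annulus_small; lra.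
by rewrite ler_pM2r in main.
Qed.

(* If the mean were farther than [5 / 2 * r] from [t0], moving the ball by
   [3 * r] towards the mean would increase [g] pointwise. *)
Lemma annulus_center : qnorm V (tsub m t0) <= 5 / 2 * r.
Proof.
rewrite leNgt; apply/negP => far.
set D := tsub m t0 in far.
have D0 : 0 < qnorm V D by apply: lt_trans far; rewrite mulr_gt0.
pose a := 3 * r / qnorm V D.
have a0 : 0 < a by rewrite divr_gt0// mulr_gt0.
have aD : a * qnorm V D = 3 * r by rewrite divfK ?gt_eqF.
have vr : qnorm V (tscale a D) = 3 * r by rewrite qnormZ gtr0_norm.
have pt t : qball t0 r t -> g t <= g (tadd t (tscale a D)).
  rewrite /qball/= => Bt; rewrite !gE ler_pM2l ?invr_gt0//.
  rewrite ler_expR !mulNr lerN2 ler_pM2l// !qformZm ler_pM2l//.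
  set u := tsub t t0 in Bt.
  have -> : tsub t m = tsub u D.
    by apply: trow_inj; rewrite !trowE opprB addrA subrK.
  have -> : tsub (tadd t (tscale a D)) m = tadd (tsub u D) (tscale a D).
    apply: trow_inj; rewrite !trowE; set A := trow t; set B := a *: _.
    by rewrite opprB [in RHS]addrA subrK addrAC.
  rewrite (qformD V (tsub u D))// bformZr bformBl qformZ.
  have bu : bform V u D <= r * qnorm V D.
    apply: le_trans (ler_norm _) _; apply: le_trans (bform_le_qnorm _ Vpos _ _) _.
    by rewrite ler_wpM2r// ltW.
  rewrite -[bform V D D]/(qform V D) -(sqr_qnorm _ Vpos D).
  rewrite -addrA gerDl.
  move: bu aD far D0; move: (qnorm V D) (bform V u D) => x b bu aD far x0.
  (* Since [a * x = 3 * r], the change of the squared distance to the mean is at most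
     [6 * r ^ 2 - 6 * r * x + 9 * r ^ 2], which is negative for [x > 5 / 2 * r]. *)
  have : a * b <= a * (r * x) by rewrite ler_pM2l.
  have -> : a * (r * x) = 3 * r ^+ 2 by rewrite mulrCA aD; ring.
  have -> : 2 * (a * (b - x ^+ 2)) + a ^+ 2 * x ^+ 2 =
    2 * (a * b) - 2 * (a * x) * x + (a * x) ^+ 2 by ring.
  rewrite aD => hab.
  have : r * (5 / 2 * r) <= r * x by rewrite ler_pM2l// ltW.
  nra.
have : ((dmass lam g (qball t0 r))%:E <=
        (dmass lam g (qball t0 (7 * r) `\` qball t0 r))%:E)%E.
  apply: le_trans (dmass_translate _ _ r0 vr); rewrite -(dmassE dg)//.
  apply: ge0_le_integral => //.
  - by move=> x _; rewrite lee_fin.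
  - by apply/measurable_EFinP; exact: measurable_funTS.
  - by apply/measurable_EFinP; exact: measurable_funTS.
rewrite lee_fin => /le_trans /(_ annulus_small).
by rewrite leNgt gtr_pMl// e1.
Qed.

(* Outside the large ball [t] is at distance at least [9 / 2 * r] from the mean, so
   half of the exponent of [g] yields the factor [expR (- (9 / 2) * c * r ^ 2)] and
   the other half is the kernel of precision [c / 2], of mass [sqrt (2 ^ p)]
   times that of precision [c]. *)
Lemma gauss_tail : dmass lam g (~` qball t0 (7 * r)) <= Num.sqrt (2 ^+ p) * e.
Proof.
have mC : measurable (~` qball t0 (7 * r)) by apply: measurableC; exact: measurable_qball.
have e0 : 0 <= e.
  by rewrite -(pmulr_lge0 _ gB_gt0); apply: le_trans annulus_small; exact: dmass_ge0 dg _.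
(* In dimension 0 the ball is the whole space, and the claim holds without the precision bound. *)
have [p0|] := posnP p.
  have -> : ~` qball t0 (7 * r) = set0.
    apply/seteqP; split => // t; rewrite /qball/= => H; apply: H.
    rewrite /qnorm /qform bform_sum big1 ?sqrtr0; first by rewrite mulr_ge0// ltW.
    by move=> [i ip]; exfalso; move: ip; rewrite p0.
  by rewrite /dmass integral_set0 mulr_ge0// sqrtr_ge0.
move=> /annulus_precision prec.
have c2 : 0 < c / 2 by rewrite divr_gt0.
set Z2 := Num.sqrt ((2 * pi) ^+ p / \det ((c / 2) *: V)).
have Z20 : 0 < Z2 by exact: gauss_norm_gt0.
pose g2 := gauss_density m ((c / 2)^-1 *: invmx V).
have dg2 : is_density lam g2 by exact: is_density_gauss.
have ZZ : Z2 = Num.sqrt (2 ^+ p) * Z.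
  rewrite /Z2 ZE -sqrtrM ?exprn_ge0//; congr Num.sqrt.
  rewrite !detZ expr_div_n !invfM invrK; ring.
pose k := expR (- (9 / 2) * c * r ^+ 2) * Num.sqrt (2 ^+ p).
apply: (@le_trans _ _ (k * dmass lam g2 (~` qball t0 (7 * r)))).
  apply: dmass_le_scale => //.
    by rewrite mulr_ge0 ?expR_ge0 ?sqrtr_ge0.
  move=> t /= /negP; rewrite -ltNge => far.
  rewrite /g2 gE gauss_densityE// -/Z2 ZZ.
  set s := Num.sqrt (2 ^+ p); have s0 : 0 < s by rewrite sqrtr_gt0 exprn_gt0.
  rewrite invfM mulrA [k * _]mulrA mulfK ?gt_eqF// [leRHS]mulrAC mulrC.
  rewrite ler_pM2r ?invr_gt0// -expRD ler_expR !qformZm.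
  have far2 : 9 / 2 * r <= qnorm V (tsub t m).
    have := qnormD _ Vpos (tsub t m) (tsub m t0).
    have -> : tadd (tsub t m) (tsub m t0) = tsub t t0.
      by apply: trow_inj; rewrite !trowE addrA subrK.
    have := annulus_center; lra.
  have : (9 / 2 * r) ^+ 2 <= qform V (tsub t m).
    by rewrite -sqr_qnorm// ler_sqr ?nnegrE ?qnorm_ge0// mulr_ge0// ltW.
  move: (qform V _) => q; rewrite exprMn => hq.
  (* The half exponent [c * q / 4] reaches [9 / 2 * c * r ^ 2] when [q] is [18 * r ^ 2], and
     [(9 / 2) ^ 2 = 81 / 4] exceeds 18. *)
  have : c * r ^+ 2 * 18 <= c * q.
    rewrite mulrAC -mulrA ler_pM2l//; apply: le_trans hq.
    by have := sqr_ge0 r; lra.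
  lra.
have := dmass_ge0 dg2 (~` qball t0 (7 * r)); have := dmass_le1 dg2 _ mC.
move: (dmass _ g2 _) => x x1 x0.
apply: (@le_trans _ _ k); first by rewrite ler_piMr// mulr_ge0 ?expR_ge0 ?sqrtr_ge0.
by rewrite /k mulrC ler_wpM2l ?sqrtr_ge0.
Qed.

End annulus.
End GaussianTail.

(** Two tolerances are kept: [e] for the ratio of the densities, and [e1] for the mass of [f]
    outside the small ball, smaller because the tail bound loses the factor [sqrt (2 ^ p)]. The
    ratio of annulus to ball is carried over from [f] to the normal density, and there [C]
    cancels. *)
Lemma dTV_gauss_le (R : realType) (p : nat) (lam : {measure set (p.-tuple R) -> \bar R})
    (V : 'M[R]_p) (f : p.-tuple R -> R) (m t0 : p.-tuple R) (c r C e e1 : R) :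
  is_lebesgue lam -> posdef V -> is_density lam f ->
  0 < c -> 0 < r -> 0 <= C -> 0 <= e <= 1 / 4 -> 0 <= e1 <= 1 / 4 -> e1 <= e ->
  Num.sqrt (2 ^+ p) * (3 * e1) <= e ->
  (forall t, qball V t0 (7 * r) t ->
     C * (1 - e) * gauss_density m (c^-1 *: invmx V) t <= f t
     <= C * (1 + e) * gauss_density m (c^-1 *: invmx V) t) ->
  dmass lam f (~` qball V t0 r) <= e1 ->
  (dTV lam f (gauss_density m (c^-1 *: invmx V)) <= (7 * e)%:E)%E.
Proof.
move=> lamL Vpos df c0 r0 C0 /andP[e0 e4] /andP[e10 e14] e1e tail fg fout.
set g := gauss_density m _ in fg *.
have dg : is_density lam g by exact: is_density_gauss.
have mB : measurable (qball V t0 r) by exact: measurable_qball.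
have mB7 : measurable (qball V t0 (7 * r)) by exact: measurable_qball.
have B17 : qball V t0 r `<=` qball V t0 (7 * r) by apply: le_qball; lra.
have mS : measurable (qball V t0 (7 * r) `\` qball V t0 r) by exact: measurableD.
have mC := measurableC mB; have mC7 := measurableC mB7.
have fB := dmass_setC df _ mB.
have fS : dmass lam f (qball V t0 (7 * r) `\` qball V t0 r) <= e1.
  by apply: le_trans fout; apply: dmass_le => // t [].
have up : dmass lam f (qball V t0 r) <= C * (1 + e) * dmass lam g (qball V t0 r).
  apply: dmass_le_scale => //; first by rewrite mulr_ge0//; lra.
  by move=> t /B17 /fg /andP[].
have lo : C * (1 - e) * dmass lam g (qball V t0 (7 * r) `\` qball V t0 r) <=
    dmass lam f (qball V t0 (7 * r) `\` qball V t0 r).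
  apply: scale_le_dmass => //; first by rewrite mulr_ge0//; lra.
  by move=> t [/fg /andP[]].
have gB0 := dmass_ge0 dg (qball V t0 r).
have gS0 := dmass_ge0 dg (qball V t0 (7 * r) `\` qball V t0 r).
have [gBp annulus] : 0 < dmass lam g (qball V t0 r) /\
  dmass lam g (qball V t0 (7 * r) `\` qball V t0 r) <=
    3 * e1 * dmass lam g (qball V t0 r).
  move: fB fS up lo gB0 gS0 fout.
  move: (dmass lam f (qball V t0 r)) (dmass lam f (~` qball V t0 r)) => x xc.
  move: (dmass lam f (_ `\` _)) (dmass lam g (_ `\` _)) (dmass lam g _) => xs ys y.
  move=> -> xs1 up lo y0 ys0 xc1.
  (* The ball gives [C * y >= (3 / 4) / (5 / 4)] and the annulus gives [C * ys <= e1 / (3 / 4)]; the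
     quotient [20 / 9 * e1] is rounded up to [3 * e1]. *)
  have Cy : 3 / 5 <= C * y.
    have : C * (1 + e) * y <= C * (5 / 4) * y.
      by apply: ler_wpM2r => //; apply: ler_wpM2l => //; lra.
    lra.
  have Cs : C * ys <= 4 / 3 * e1.
    have : C * (3 / 4) * ys <= C * (1 - e) * ys.
      by apply: ler_wpM2r => //; apply: ler_wpM2l => //; lra.
    lra.
  have Cp : 0 < C.
    by rewrite lt_def C0 andbT; apply/eqP => C00; move: Cy; rewrite C00 mul0r; lra.
  split; first by rewrite -(pmulr_rgt0 _ Cp); lra.
  rewrite -(ler_pM2l Cp); apply: le_trans Cs _.
  have : 3 / 5 * e1 <= C * y * e1 by apply: ler_wpM2r.
  lra.
apply: dTV_le => //; apply: (dmass_close df dg mB7 C0) => //.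
- by rewrite e0 e4.
- by apply: le_trans e1e; apply: le_trans fout; apply: dmass_le => //; exact: subsetC.
- apply: le_trans tail.
  apply: (gauss_tail _ lamL _ Vpos c m t0 g _ c0 erefl _ dg) => //.
  + by move=> t; exact: gauss_densityE.
  + by lra.
Qed.

(** * From radii tending to infinity to one fixed radius *)

Section ErealSequences.
Context {R : realType}.

Lemma cvge0_le_near (u : nat -> \bar R) : u @ \oo --> 0%E ->
  forall e : R, 0 < e -> \forall n \near \oo, (u n < e%:E)%E.
Proof.
move=> u0 e e0; apply: (u0 [set x | (x < e%:E)%E]).
by apply: open_nbhs_nbhs; split; [exact: open_ereal_lt_ereal|rewrite /= lte_fin].
Qed.

Lemma near_le_cvge0 (u : nat -> \bar R) : (forall n, 0 <= u n)%E ->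
  (forall e : R, 0 < e -> \forall n \near \oo, (u n <= e%:E)%E) -> u @ \oo --> 0%E.
Proof.
move=> u0 H; apply/fine_cvgP; split.
  have := H 1 ltr01; apply: filterS => n un.
  by rewrite ge0_fin_numE// (le_lt_trans un)// ltry.
apply/cvgrPdist_le => e e0; near=> n.
have un : (u n <= e%:E)%E by near: n; exact: H.
have uf : u n \is a fin_num by rewrite ge0_fin_numE// (le_lt_trans un)// ltry.
rewrite sub0r normrN ger0_norm ?fine_ge0//.
by rewrite -lee_fin fineK.
Unshelve. all: by end_near. Qed.

(* If no fixed radius works, choose [f k >= k] with [E (f k) k > kappa]; the radius
   [max {k | f k = n}] (or [n] when no such [k] exists) tends to infinity and
   contradicts the hypothesis. *)
Lemma cvge0_radius (E : nat -> R -> \bar R) :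
  (forall r : nat -> R, r @ \oo --> +oo -> (fun n => E n (r n)) @ \oo --> 0%E) ->
  forall kappa : R, 0 < kappa ->
  exists k : nat, \forall n \near \oo, (E n k%:R <= kappa%:E)%E.
Proof.
move=> HE kappa k0; apply: contrapT => nH.
have Hk k : exists n, (k <= n)%N /\ (kappa%:E < E n k%:R)%E.
  apply: contrapT => nk; apply: nH; exists k; exists k => // n kn.
  by rewrite leNgt; apply/negP => lt; apply: nk; exists n.
have [f Hf] := choice Hk.
(* Since [k <= f k], every index with value [n] is at most [n], so a finite maximum suffices. *)
pose r n := (if [exists k : 'I_n.+1, f k == n] then
   \max_(k < n.+1 | f k == n) (k : nat) else n)%N.
(* At a value of [f] the maximum is attained, so the radius there is itself an index with that
   value. *)
have rP k : exists k', r (f k) = k' /\ f k' = f k.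
  rewrite /r; case: ifPn => [/existsP[j fj]|].
    have [i /eqP fi ->] := @eq_bigmax_cond _ [pred i : 'I_(f k).+1 | f i == f k]
      (fun i => i : nat) (ltac:(by apply/card_gt0P; exists j)).
    by exists i.
  rewrite negb_exists => /forallP/(_ (Ordinal (ltac:(rewrite ltnS; exact: (Hf k).1) : (k < (f k).+1)%N))).
  by rewrite eqxx.
have roo : (fun n => (r n)%:R : R) @ \oo --> +oo.
  apply/cvgryPge => A; pose m := (Num.trunc `|A|).+1.
  have Am : A <= m%:R by apply: le_trans (ler_norm _) _; exact/ltW/truncnS_gt.
  (* Once [n] exceeds all [f k] with [k < m], any index with value [n] is at least [m]. *)
  exists (maxn m (\max_(k < m) f k).+1) => // n /= mn.
  apply: le_trans Am _; rewrite ler_nat.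
  rewrite leqNgt; apply/negP => rm.
  move: mn; rewrite geq_max => /andP[mn fn].
  move: rm; rewrite {1}/r; case: ifPn => [|_]; last by rewrite ltnNge mn.
  move=> /existsP[j fj] rm.
  have jm : (j < m)%N.
    by apply: leq_ltn_trans rm; exact: (@leq_bigmax_cond _ (fun i : 'I_n.+1 => f i == n) (fun i => i : nat)).
  have := @leq_bigmax _ (fun k : 'I_m => f k) (Ordinal jm).
  by rewrite /= (eqP fj) leqNgt fn.
have [N _ HN] := cvge0_le_near _ (HE _ roo) _ k0.
have [k' [rk fk]] := rP N.
have := HN (f N) (Hf N).1; rewrite rk -fk => /lt_trans /(_ (Hf k').2).
by rewrite ltxx.
Qed.

End ErealSequences.

(** * Outer probability and Markov's inequality *)

Section OuterProbability.
Context {d} {Om : measurableType d} {R : realType} (P : probability Om R).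

Lemma outerP_ge0 A : (0 <= outerP P A)%E.
Proof. by apply: le_ereal_inf_tmp => _ [B [mB _] <-]; exact: measure_ge0. Qed.

(** The event [B1] may fail to be measurable, so it is replaced by a measurable cover of probability
    below [e1]. *)
Lemma outerP_le_add (A B1 B2 : set Om) (e1 e2 : R) : measurable B2 ->
  A `<=` B1 `|` B2 -> (outerP P B1 < e1%:E)%E -> (P B2 <= e2%:E)%E ->
  (outerP P A <= (e1 + e2)%:E)%E.
Proof.
move=> mB2 AB /ereal_inf_lt[_ [B [mB B1B] <-]] PB PB2.
apply: (@le_trans _ _ (P (B `|` B2))).
  apply: ge_ereal_inf; exists (P (B `|` B2)) => //; exists (B `|` B2) => //.
  split; first exact: measurableU.
  by apply: subset_trans AB _; exact: setSU.
by rewrite EFinD (le_trans (measureU2 _ _ _))// leeD// ltW.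
Qed.

Lemma markov_ineq (h : Om -> \bar R) (e : R) : measurable_fun setT h ->
  (forall w, 0 <= h w)%E -> 0 < e ->
  (e%:E * P [set w | e%:E <= h w] <= \int[P]_w h w)%E.
Proof.
move=> mh h0 e0.
have := le_integral_abse P measurableT mh e0; rewrite setTI.
under eq_set do rewrite gee0_abs//.
by under eq_integral do rewrite gee0_abs//.
Qed.

End OuterProbability.

(** * The posterior as a density, and its measurability in the sample point *)

Lemma measurable_indic_snd {R : realType} d1 d2 (T1 : measurableType d1)
    (T2 : measurableType d2) (A : set T2) : measurable A ->
  measurable_fun setT (fun z : T1 * T2 => \1_A z.2 : R).
Proof.
move=> mA; have mi : measurable_fun setT (\1_A : T2 -> R) by exact: measurable_indic.
exact: (measurableT_comp mi (measurable_snd : measurable_fun setT (@snd T1 T2))).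
Qed.

Lemma integral_is_lebesgue {R : realType} {p : nat}
    {m1 m2 : {measure set (p.-tuple R) -> \bar R}} : is_lebesgue m1 -> is_lebesgue m2 ->
  forall D f, (\int[m1]_(x in D) f x = \int[m2]_(x in D) f x)%E.
Proof.
by move=> l1 l2 D f; apply: eq_measure_integral => A mA _; exact: is_lebesgue_unique.
Qed.

Section Posterior.
Context {R : realType} {p : nat} {dX : measure_display} {XX : measurableType dX}.
Context {d : measure_display} {Om : measurableType d}.
Variable lam : {measure set (p.-tuple R) -> \bar R}.
Hypothesis lamL : is_lebesgue lam.
Variables (X : nat -> Om -> XX) (Theta : set (p.-tuple R)).
Variables (rho : XX -> p.-tuple R -> R) (prior : p.-tuple R -> R) (alpha : nat -> R).
Hypothesis mX : forall i, measurable_fun setT (X i).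
Hypothesis mTheta : measurable Theta.
Hypothesis rho0 : forall x t, 0 <= rho x t.
Hypothesis mrho : measurable_fun setT (fun z : XX * p.-tuple R => rho z.1 z.2).
Hypothesis alpha0 : forall i, 0 < alpha i.
Hypothesis mprior : measurable_fun setT prior.
Hypothesis prior0 : forall t, 0 <= prior t.
Hypothesis prior1 : (\int[lam]_(t in Theta) (prior t)%:E = 1)%E.

Lemma measurable_wloss_pair n :
  measurable_fun setT (fun z : Om * p.-tuple R => wloss rho alpha X n z.1 z.2).
Proof.
rewrite /wloss; apply: measurable_sum => i; apply: measurable_funM => //.
apply: (measurableT_comp mrho (g := fun z : Om * p.-tuple R => (X i z.1, z.2))).
by apply: measurable_fun_pair => //=; exact: measurableT_comp.
Qed.

Definition unnormalized n (w : Om) (t : p.-tuple R) : R :=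
  expR (- wloss rho alpha X n w t) * prior t.

Lemma measurable_unnormalized_pair n :
  measurable_fun setT (fun z : Om * p.-tuple R => unnormalized n z.1 z.2).
Proof.
apply: measurable_funM; last exact: measurableT_comp.
apply: measurableT_comp => //; apply: measurableT_comp => //.
exact: measurable_wloss_pair.
Qed.

Lemma measurable_unnormalized n w : measurable_fun setT (unnormalized n w).
Proof.
exact: (measurableT_comp (measurable_unnormalized_pair n) (pair1_measurable w)).
Qed.

Lemma unnormalized_ge0 n w t : 0 <= unnormalized n w t.
Proof. by rewrite mulr_ge0 ?expR_ge0. Qed.

Lemma wloss_ge0 n w t : 0 <= wloss rho alpha X n w t.
Proof. by apply: sumr_ge0 => i _; rewrite mulr_ge0// ltW. Qed.

Definition normalizer n w : R := fine (\int[lam]_(t in Theta) (unnormalized n w t)%:E)%E.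

Lemma integral_unnormalized_le1 n w :
  (\int[lam]_(t in Theta) (unnormalized n w t)%:E <= 1)%E.
Proof.
rewrite -prior1; apply: ge0_le_integral => //.
- by move=> t _; rewrite lee_fin unnormalized_ge0.
- apply/measurable_EFinP; apply: measurable_funTS; exact: measurable_unnormalized.
- by apply/measurable_EFinP; exact: measurable_funTS.
- move=> t _; rewrite lee_fin ler_piMl// -expR0 ler_expR oppr_le0.
  exact: wloss_ge0.
Qed.

Lemma normalizerE n w :
  (\int[lam]_(t in Theta) (unnormalized n w t)%:E = (normalizer n w)%:E)%E.
Proof.
rewrite /normalizer fineK// ge0_fin_numE; last first.
  by apply: integral_ge0 => t _; rewrite lee_fin unnormalized_ge0.
by rewrite (le_lt_trans (integral_unnormalized_le1 n w))// ltry.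
Qed.

(** If it vanished, the unnormalized density would be zero almost everywhere on [Theta], hence so
    would the prior, the exponential being positive; but the prior integrates to 1. *)
Lemma normalizer_gt0 n w : 0 < normalizer n w.
Proof.
rewrite lt_def; apply/andP; split; last first.
  by apply: fine_ge0; apply: integral_ge0 => t _; rewrite lee_fin unnormalized_ge0.
apply/eqP => N0; have := normalizerE n w; rewrite N0 => I0.
have mu : measurable_fun Theta (EFin \o unnormalized n w).
  by apply/measurable_EFinP; apply: measurable_funTS; exact: measurable_unnormalized.
have mp : measurable_fun Theta (EFin \o prior).
  by apply/measurable_EFinP; exact: measurable_funTS.
have [H _] := ae_eq_integral_abs lam mTheta mu.
have {}H : ae_eq lam Theta (EFin \o unnormalized n w) (cst 0%E).
  apply: H; rewrite -[RHS]I0; apply: eq_integral => t _ /=.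
  by rewrite ger0_norm// unnormalized_ge0.
have [_ H2] := ae_eq_integral_abs lam mTheta mp.
have : (\int[lam]_(t in Theta) `|(EFin \o prior) t| = 0)%E.
  apply: H2; move: H; apply: filterS => t + Tt => /(_ Tt) /=.
  move=> [/eqP]; rewrite mulf_eq0 gt_eqF ?expR_gt0//= => /eqP ->//.
have -> : (\int[lam]_(t in Theta) `|(EFin \o prior) t| = 1)%E.
  by rewrite -prior1; apply: eq_integral => t _ /=; rewrite ger0_norm.
by move=> /eqP; rewrite onee_eq0.
Qed.

Lemma mposteriorE n w t : mposterior rho alpha X lam Theta prior n w t =
  \1_Theta t * unnormalized n w t / normalizer n w.
Proof. by []. Qed.

Lemma is_density_mposterior n w :
  is_density lam (mposterior rho alpha X lam Theta prior n w).
Proof.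
have N0 := normalizer_gt0 n w.
have m1 : measurable_fun setT (fun t => \1_Theta t * unnormalized n w t).
  by apply: measurable_funM; [exact: measurable_indic|exact: measurable_unnormalized].
have p0 t : 0 <= \1_Theta t * unnormalized n w t.
  by rewrite mulr_ge0// ?unnormalized_ge0.
split.
- by apply: measurable_funM.
- by move=> t; rewrite mposteriorE divr_ge0// ltW.
- transitivity ((normalizer n w)^-1%:E *
     \int[lam]_t (\1_Theta t * unnormalized n w t)%:E)%E.
    rewrite -ge0_integralZl//.
    + by apply: eq_integral => t _; rewrite -EFinM mposteriorE mulrC.
    + by apply/measurable_EFinP.
    + by move=> t _; rewrite lee_fin.
    + by rewrite lee_fin invr_ge0 ltW.
  rewrite (_ : \int[lam]_t _ = (normalizer n w)%:E)%E; last first.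
    rewrite -normalizerE [RHS]integral_mkcond; apply: eq_integral => t _.
    rewrite patchE indicE; case: ifPn => _; first by rewrite mul1r.
    by rewrite mul0r.
  by rewrite -EFinM mulVf// gt_eqF.
Qed.

(** Tonelli's theorem for the sigma-finite model gives measurability of an integral depending on the
    sample point. *)
Lemma measurable_normalizer n : measurable_fun setT (normalizer n).
Proof.
have [nu nuL _] := @exists_lebesgue_gauss R p.
apply: (measurableT_comp (fine_measurable measurableT)).
have -> : (fun w => \int[lam]_(t in Theta) (unnormalized n w t)%:E)%E =
   fubini_F nu (fun z : Om * p.-tuple R => (\1_Theta z.2 * unnormalized n z.1 z.2)%:E).
  apply/funext => w; rewrite /fubini_F (integral_is_lebesgue lamL nuL).
  rewrite [LHS]integral_mkcond; apply: eq_integral => t _.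
  rewrite patchE indicE /=; case: ifPn => _; first by rewrite mul1r.
  by rewrite mul0r.
apply: measurable_fun_fubini_tonelli_F.
- apply/measurable_EFinP; apply: measurable_funM; last exact: measurable_unnormalized_pair.
  exact: measurable_indic_snd.
- by move=> z; rewrite lee_fin mulr_ge0 ?unnormalized_ge0.
Qed.

(** Kept in the form of the concentration condition; [outer_massE] identifies it with a mass over
    the whole space. *)
Definition outer_mass (S : set (p.-tuple R)) n w : \bar R :=
  (\int[lam]_(t in Theta) (\1_S t * mposterior rho alpha X lam Theta prior n w t)%:E)%E.

Lemma outer_massE S n w : measurable S ->
  outer_mass S n w =
  (dmass lam (mposterior rho alpha X lam Theta prior n w) S)%:E.
Proof.
move=> mS; rewrite -(dmassE (is_density_mposterior n w))// /outer_mass.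
rewrite [LHS]integral_mkcond [RHS]integral_mkcond; apply: eq_integral => t _.
rewrite !patchE mposteriorE !indicE.
by case: (t \in S); case: (t \in Theta); rewrite ?mul1r ?mul0r.
Qed.

Lemma measurable_outer_mass S n : measurable S -> measurable_fun setT (outer_mass S n).
Proof.
move=> mS; have [nu nuL _] := @exists_lebesgue_gauss R p.
(* The inverse normalizer is written as a power of exponent [-1], a measurable function on the whole
   line; positivity makes the two agree. *)
have -> : outer_mass S n = fubini_F nu (fun z : Om * p.-tuple R =>
    (\1_(S `&` Theta) z.2 * unnormalized n z.1 z.2 * normalizer n z.1 `^ (-1))%:E).
  apply/funext => w; rewrite /fubini_F /outer_mass (integral_is_lebesgue lamL nuL).
  rewrite [LHS]integral_mkcond.
  apply: eq_integral => t _.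
  rewrite patchE /= mposteriorE !indicE in_setI powR_inv1 ?ltW ?normalizer_gt0//.
  by case: (t \in S); case: (t \in Theta); rewrite ?mul1r ?mul0r.
apply: measurable_fun_fubini_tonelli_F.
- apply/measurable_EFinP; apply: measurable_funM.
    apply: measurable_funM; last exact: measurable_unnormalized_pair.
    by apply: measurable_indic_snd; exact: measurableI.
  apply: (measurableT_comp (measurable_powR (-1))).
  exact: (measurableT_comp (measurable_normalizer n)).
- by move=> z; rewrite lee_fin mulr_ge0 ?powR_ge0// mulr_ge0 ?unnormalized_ge0.
Qed.

Lemma outer_mass_ge0 S n w : (0 <= outer_mass S n w)%E.
Proof.
apply: integral_ge0 => t _; rewrite lee_fin mulr_ge0//.
by have [_ + _] := is_density_mposterior n w; apply.
Qed.

End Posterior.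

(** * The LAN expansion around the estimator *)

Section LocalExpansion.
Context {R : realType} {p : nat} {dX : measure_display} {XX : measurableType dX}.
Context {d : measure_display} {Om : measurableType d}.
Variables (X : nat -> Om -> XX) (rho : XX -> p.-tuple R -> R) (alpha : nat -> R).
Variables (V : 'M[R]_p) (thetas : p.-tuple R) (thhat : nat -> Om -> p.-tuple R).
Hypothesis Vpos : posdef V.

Definition local_coord n (t : p.-tuple R) : p.-tuple R :=
  tscale (Num.sqrt n%:R) (tsub t thetas).

(** Completing the square: the linear term moves the centre of the quadratic form from [thetas] to
    [thhat n w], and undoing the scaling by [sqrt n] produces the precision [alphabar * n]. The
    first two terms are free of [t] and enter the proportionality constant. *)
Lemma wloss_lan_rem n w t : (0 < n)%N ->
  - wloss rho alpha X n w t = - wloss rho alpha X n w thetas +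
    1 / 2 * (alphabar alpha n * n%:R) * qform V (tsub (thhat n w) thetas) -
    1 / 2 * (alphabar alpha n * n%:R) * qform V (tsub t (thhat n w)) +
    lan_rem rho alpha X V thetas thhat n w (local_coord n t).
Proof.
move=> n0; have sn : Num.sqrt (n%:R : R) != 0 by rewrite sqrtr_eq0 -ltNge ltr0n.
rewrite /lan_rem /local_coord bformZl bformZr qformZ.
have -> : tadd thetas (tscale (Num.sqrt n%:R)^-1
    (tscale (Num.sqrt n%:R) (tsub t thetas))) = t.
  by apply: trow_inj; rewrite !trowE scalerA mulVf// scale1r addrC subrK.
under eq_bigr do rewrite mulrBr.
rewrite sumrB /wloss.
have -> : tsub t (thhat n w) = tsub (tsub t thetas) (tsub (thhat n w) thetas).
  by apply: trow_inj; rewrite !trowE opprB addrA subrK.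
rewrite (qformB V (tsub t thetas)); last by case: Vpos.
have -> : forall x : R, Num.sqrt n%:R * (Num.sqrt n%:R * x) = n%:R * x.
  by move=> x; rewrite mulrA -expr2 sqr_sqrtr// ler0n.
rewrite sqr_sqrtr ?ler0n//.
move: (alphabar alpha n) (\sum_(i < n) _ * _ t) (\sum_(i < n) _ * _ thetas) => a x y.
by field.
Qed.

End LocalExpansion.

(** * Elementary bounds for the final estimate *)

(** The factor 4 comes from [(1 + s) / (1 - s) <= 1 + 4 * s] for [s <= 1 / 2]; the upper bound on
    [expR x] follows from [1 - x <= expR (- x)]. *)
Lemma expR_ratio_bounds {R : realType} (s x y : R) : 0 <= s <= 1 / 2 ->
  `|x| <= s -> 1 - s <= y <= 1 + s -> 1 - 4 * s <= expR x * y <= 1 + 4 * s.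
Proof.
move=> /andP[s0 s2]; rewrite ler_norml => /andP[x1 x2] /andP[y1 y2].
have e1 : 1 - s <= expR x by apply: le_trans (expR_ge1Dx _); lra.
have e2 : expR x * (1 - s) <= 1.
  have : 1 - x <= expR (- x) by apply: le_trans (expR_ge1Dx _); lra.
  move=> h; apply: (@le_trans _ _ (expR x * expR (- x))).
    by apply: ler_wpM2l; [exact: expR_ge0|lra].
  by rewrite -expRD subrr expR0.
have e0 := expR_gt0 x; move: (expR x) e0 e1 e2 => E e0 e1 e2.
have h1 : (1 - s) * (1 - s) <= E * y by apply: ler_pM => //; lra.
have h2 : E * y <= E * (1 + s) by rewrite ler_pM2l.
have ss : s * s <= 1 / 2 * s by apply: ler_wpM2r.
have h3 : E * (1 + s) <= 1 + 4 * s.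
  apply: (@le_trans _ _ (E * (1 - s) * (1 + 4 * s))).
    rewrite -mulrA ler_pM2l//; lra.
  by rewrite ler_piMl//; lra.
have ss0 : 0 <= s * s by exact: mulr_ge0.
by apply/andP; split; lra.
Qed.

Lemma sandwich_factor {R : realType} (C g y e : R) : 0 <= C * g ->
  1 - e <= y <= 1 + e -> C * (1 - e) * g <= C * g * y <= C * (1 + e) * g.
Proof.
move=> Cg /andP[y1 y2].
by rewrite ![C * _ * g]mulrAC !ler_wpM2l.
Qed.

Lemma near_sqrtn_gt {R : realType} (A : R) : \forall n \near \oo, A < Num.sqrt (n%:R : R).
Proof.
exists (Num.trunc (A ^+ 2)).+1 => // n /= An.
apply: le_lt_trans (ler_norm _) _; rewrite -sqrtr_sqr ltr_sqrt; last first.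
  by rewrite ltr0n (leq_trans _ An).
by apply: lt_le_trans (truncnS_gt _) _; rewrite ler_nat.
Qed.

Lemma enormE {R : realType} {p : nat} (h : p.-tuple R) : enorm h = qnorm 1%:M h.
Proof. by rewrite /qnorm -sqr_enorm sqrtr_sqr ger0_norm// enorm_ge0. Qed.

Lemma enormZ {R : realType} {p : nat} (a : R) (h : p.-tuple R) :
  enorm (tscale a h) = `|a| * enorm h.
Proof. by rewrite !enormE qnormZ. Qed.

Lemma cube_norm {R : realType} {p : nat} (r : R) (h : p.-tuple R) :
  (forall i, `|tnth h i| <= r) -> cube r h.
Proof. by move=> H i; have := H i; rewrite ler_norml !tnth_mktuple. Qed.

Lemma measurable_enorm_gt {R : realType} {p : nat} (a r : R) (t0 : p.-tuple R) :
  measurable [set t : p.-tuple R | r < enorm (tscale a (tsub t t0))].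
Proof.
have -> : [set t : p.-tuple R | r < enorm (tscale a (tsub t t0))] =
    (fun t => `|a| * qnorm 1%:M (tsub t t0)) @^-1` `]r, +oo[.
  by apply/seteqP; split => t /=; rewrite in_itv/= andbT enormZ enormE.
rewrite -[X in measurable X]setTI.
have mf : measurable_fun setT (fun t : p.-tuple R => `|a| * qnorm 1%:M (tsub t t0)).
  by apply: measurable_funM => //; exact: measurable_qnorm.
exact: mf.
Qed.

(** * Convergence in total variation *)

(** The failure event is covered by two others: the LAN remainder exceeds [e / 4] somewhere on a
    fixed cube, or the posterior mass outside radius [k / sqrt n] is at least [e1]. For large [n]
    each has outer probability at most [eta / 2], and off both the deterministic bound of
    [dTV_gauss_le] applies. *)
Lemma bernstein_von_mises (R : realType) (p : nat)
  (dX : measure_display) (XX : measurableType dX)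
  (d : measure_display) (Om : measurableType d)
  (P : probability Om R) (X : nat -> Om -> XX)
  (lam : {measure set (p.-tuple R) -> \bar R})
  (Theta : set (p.-tuple R)) (rho : XX -> p.-tuple R -> R)
  (prior : p.-tuple R -> R) (alpha : nat -> R) (thetas : p.-tuple R)
  (thhat : nat -> Om -> p.-tuple R) (V : 'M[R]_p) :
  is_lebesgue lam ->
  (forall i, measurable_fun setT (X i)) ->
  measurable Theta ->
  tinterior Theta thetas ->
  (forall x t, 0 <= rho x t) ->
  measurable_fun setT (fun z : XX * p.-tuple R => rho z.1 z.2) ->
  (forall i, 0 < alpha i) ->
  measurable_fun setT prior ->
  (forall t, 0 <= prior t) ->
  (\int[lam]_(t in Theta) (prior t)%:E = 1)%E ->
  0 < prior thetas -> tcont_at prior thetas ->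
  posdef V ->
  (forall K : set (p.-tuple R), tcompact K -> forall eps : R, 0 < eps ->
     (fun n => outerP P [set w | exists2 h, K h &
        eps < `|lan_rem rho alpha X V thetas thhat n w h|]) @ \oo --> 0%E) ->
  (forall r : nat -> R, r @ \oo --> +oo ->
     (fun n => (\int[P]_w (\int[lam]_(t in Theta)
        (\1_[set t | r n < enorm (tscale (Num.sqrt n%:R) (tsub t thetas))] t *
         mposterior rho alpha X lam Theta prior n w t)%:E))%E) @ \oo --> 0%E) ->
  forall eps : R, 0 < eps ->
    (fun n => outerP P [set w | (eps%:E <
        dTV lam (mposterior rho alpha X lam Theta prior n w)
          (gauss_density (thhat n w) ((alphabar alpha n * n%:R)^-1 *: invmx V)))%E])
    @ \oo --> 0%E.
Proof.
move=> lamL mX mTheta [r1 r10 Hr1] rho0 mrho alpha0 mprior prior0 prior1 pth cth.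
move=> Vpos LAN conc eps eps0.
pose e := Num.min (1 / 4) (eps / 7).
have e0 : 0 < e by rewrite lt_min divr_gt0//= divr_gt0.
have e4 : e <= 1 / 4 by rewrite ge_min lexx.
have e42 : 0 <= e / 4 <= 1 / 2 by apply/andP; split; lra.
have e7 : 7 * e <= eps by rewrite mulrC -ler_pdivlMr// ge_min lexx orbT.
pose sq : R := Num.sqrt (2 ^+ p).
have sq1 : 1 <= sq by rewrite -[leLHS]sqrtr1 ler_sqrt ?exprn_ge0// exprn_ege1// ler1n.
have sq0 : 0 < sq by apply: lt_le_trans sq1.
(* Chosen so that [sqrt (2 ^ p) * (3 * e1)] is exactly [e], the tail allowed by [dTV_gauss_le]. *)
pose e1 := e / (3 * sq).
have e10 : 0 < e1 by rewrite divr_gt0// mulr_gt0.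
have sqe1 : sq * (3 * e1) = e by rewrite /e1; field; rewrite gt_eqF.
have e1e : e1 <= e.
  by rewrite ler_pdivrMr ?mulr_gt0// ler_peMr ?(ltW e0)//; lra.
have [C1 C10 HC1] := qnorm_le_enorm _ Vpos.
have [C2 C20 HC2] := posdef_coord_bound _ Vpos.
(* The prior and the remainder each get the tolerance [e / 4], which [expR_ratio_bounds] multiplies
   by 4. *)
have s0 : 0 < e / 4 * prior thetas by rewrite mulr_gt0// divr_gt0.
have [r2 r20 Hr2] := cth _ s0.
pose r := Num.min r1 r2.
have rp : 0 < r by rewrite lt_min r10.
pose S n (k : R) := [set t | k < enorm (tscale (Num.sqrt n%:R) (tsub t thetas))].
have mS n k : measurable (S n k) by exact: measurable_enorm_gt.
pose om := outer_mass lam X Theta rho prior alpha.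
have om_ge0 A n w : (0 <= om A n w)%E by exact: outer_mass_ge0.
have mom n k : measurable_fun setT (om (S n k) n) by exact: measurable_outer_mass.
have om_rad := @cvge0_radius R (fun n k => \int[P]_w om (S n k) n w)%E conc.
apply: near_le_cvge0 => [n|eta eta0]; first exact: outerP_ge0.
have eta2 : 0 < eta / 2 by rewrite divr_gt0.
(* Markov's inequality at level [e1] turns this bound on the expectation into the probability
   [eta / 2]. *)
have [k Hk] := om_rad _ (mulr_gt0 e10 eta2).
(* A local coordinate of [V]-norm above [M] has Euclidean norm above [k + 1]; adding 1 keeps [M]
   positive when [k] is 0. *)
pose M := C1 * (k%:R + 1).
have M0 : 0 < M by rewrite mulr_gt0// ltr_wpDl.
have e40 : 0 < e / 4 by rewrite divr_gt0.
have LANn := cvge0_le_near _ (LAN _ (tcompact_cube (C2 * (7 * M))) _ e40) _ eta2.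
near=> n.
have n0 : (0 < n)%N by near: n; exists 1%N.
(* Puts the ball of radius [7 * M / sqrt n] within [r] of [thetas], hence inside [Theta] and where
   the prior is nearly constant. *)
have sn : C2 * (7 * M) * p.+1%:R / r < Num.sqrt (n%:R : R).
  by near: n; exact: near_sqrtn_gt.
have sqn0 : 0 < Num.sqrt (n%:R : R) by rewrite sqrtr_gt0 ltr0n.
pose c := alphabar alpha n * n%:R.
have c0 : 0 < c.
  rewrite /c /alphabar mulr_gt0 ?ltr0n// mulr_gt0 ?invr_gt0 ?ltr0n//.
  rewrite (bigD1 (Ordinal n0))//= ltr_wpDr ?alpha0//.
  by apply: sumr_ge0 => i _; exact: ltW.
pose B := [set w | (e1%:E <= om (S n k%:R) n w)%E].
have mB : measurable B.
  rewrite (_ : B = om (S n k%:R) n @^-1` `[e1%:E, +oo[%classic); last first.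
    by apply/seteqP; split => w /=; rewrite in_itv/= andbT.
  by rewrite -[X in measurable X]setTI; apply: mom => //; exact: emeasurable_itv.
have PB1 : (outerP P [set w | exists2 h, cube (C2 * (7 * M)) h &
    (e / 4 < `|lan_rem rho alpha X V thetas thhat n w h|)%R] < (eta / 2)%:E)%E.
  by near: n.
rewrite [eta]splitr; apply: (outerP_le_add _ _ _ _ _ _ mB); first last.
- have := markov_ineq P _ _ (mom n k%:R) (om_ge0 _ _) e10.
  have /[swap] /le_trans /[apply] : (\int[P]_w om (S n k%:R) n w <= (e1 * (eta / 2))%:E)%E.
    by near: n.
  by move=> h; rewrite -(@lee_pmul2l _ e1%:E) ?lte_fin// -EFinM.
- exact: PB1.
move=> w /= far; apply: contrapT => /not_orP[nb1 nb2].
suff : (dTV lam (mposterior rho alpha X lam Theta prior n w)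
    (gauss_density (thhat n w) (c^-1 *: invmx V)) <= (7 * e)%:E)%E.
  move=> /(lt_le_trans far); rewrite lte_fin ltNge e7//.
have fdens : is_density lam (mposterior rho alpha X lam Theta prior n w).
  exact: is_density_mposterior.
set N := normalizer lam X Theta rho prior alpha n w.
have N0 : 0 < N by exact: normalizer_gt0.
pose Z := Num.sqrt ((2 * pi) ^+ p / \det (c *: V)).
have Z0 : 0 < Z by exact: gauss_norm_gt0.
(* Collects the factors free of [t]; [Z] compensates the normalization of the normal density. Only
   its sign is checked, its size being controlled by comparing masses. *)
pose C := expR (- wloss rho alpha X n w thetas +
  1 / 2 * c * qform V (tsub (thhat n w) thetas)) * Z * prior thetas / N.
have C0 : 0 <= C by rewrite divr_ge0 ?ltW// mulr_gt0// mulr_gt0// expR_gt0.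
apply: (@dTV_gauss_le _ _ lam V _ _ thetas c (M / Num.sqrt n%:R) C e e1) => //.
- by rewrite divr_gt0.
- by rewrite (ltW e0).
- by rewrite (ltW e10)/=; lra.
- by rewrite sqe1.
- move=> t; rewrite /qball/= => tB.
  have hq : qnorm V (local_coord thetas n t) <= 7 * M.
    by rewrite qnormZ gtr0_norm// mulrC -ler_pdivlMr// -mulrA.
  have near_t : enorm (tsub t thetas) < r.
    apply: enorm_lt => // i; apply: le_lt_trans (HC2 _ i) _.
    apply: le_lt_trans (ler_wpM2l (ltW C20) tB) _.
    rewrite ltr_pdivlMr ?ltr0n//; move: sn; rewrite ltr_pdivrMr// => sn.
    rewrite [ltLHS](_ : _ = C2 * (7 * M) * p.+1%:R / Num.sqrt n%:R); last by ring.
    by rewrite ltr_pdivrMr// (mulrC r).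
  have Tt : Theta t by apply: Hr1; apply: lt_le_trans near_t _; rewrite ge_min lexx.
  have pt : `|prior t - prior thetas| < e / 4 * prior thetas.
    by apply: Hr2; apply: lt_le_trans near_t _; rewrite ge_min lexx orbT.
  have lr : `|lan_rem rho alpha X V thetas thhat n w (local_coord thetas n t)| <= e / 4.
    rewrite leNgt; apply/negP => lr; apply: nb1; exists (local_coord thetas n t) => //.
    by apply: cube_norm => i; apply: le_trans (HC2 _ i) _; rewrite ler_pM2l.
  have fE : mposterior rho alpha X lam Theta prior n w t =
    C * gauss_density (thhat n w) (c^-1 *: invmx V) t *
     (expR (lan_rem rho alpha X V thetas thhat n w (local_coord thetas n t)) *
      (prior t / prior thetas)).
    rewrite mposteriorE indicE mem_set// mul1r -/N gauss_densityE// -/Z /unnormalized.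
    rewrite (wloss_lan_rem X rho alpha V thetas thhat Vpos)// -/c /gauss_kernel qformZm /C.
    move: (lan_rem _ _ _ _ _ _ _ _ _) (qform V (tsub t _)) => L q.
    move: (- wloss _ _ _ _ _ _ + _) => a.
    have -> : a - 1 / 2 * c * q + L = a + - (1 / 2) * (c * q) + L by ring.
    rewrite !expRD; move: (expR _) (expR _) (expR _) (prior t) => E1 E2 E3 pr.
    by field; rewrite !gt_eqF.
  have ratio : 1 - e / 4 <= prior t / prior thetas <= 1 + e / 4.
    move: pt; rewrite ltr_norml => /andP[pt1 pt2].
    rewrite ler_pdivlMr// ler_pdivrMr//; apply/andP; split; lra.
  rewrite fE; apply: sandwich_factor.
    by rewrite mulr_ge0//; case: (is_density_gauss _ lamL _ Vpos _ (thhat n w) c0).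
  by have := expR_ratio_bounds _ _ _ e42 lr ratio; rewrite [4 * _]mulrC divfK.
- have : ~~ (e1%:E <= om (S n k%:R) n w)%E by exact/negP.
  rewrite -ltNge /om outer_massE// lte_fin => /ltW /(le_trans _); apply.
  apply: (dmass_le fdens) => //.
    by apply: measurableC; exact: measurable_qball.
  move=> t /= /negP; rewrite -ltNge ltr_pdivrMr// => tB.
  rewrite /S /= enormZ gtr0_norm//.
  have : C1 * (k%:R + 1) < C1 * (enorm (tsub t thetas) * Num.sqrt n%:R).
    apply: lt_le_trans tB _; rewrite mulrA.
    by apply: ler_wpM2r; [exact: ltW|exact: HC1].
  by rewrite ltr_pM2l// mulrC; apply: le_lt_trans; rewrite lerDl.
Unshelve. all: by end_near. Qed.

Theorem mainTheorem1 (R : realType) (p : nat)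
  (dX : measure_display) (XX : measurableType dX)
  (d : measure_display) (Om : measurableType d)
  (P : probability Om R) (P0 : probability XX R) (X : nat -> Om -> XX)
  (lam : {measure set (p.-tuple R) -> \bar R})
  (Theta : set (p.-tuple R)) (rho : XX -> p.-tuple R -> R)
  (prior : p.-tuple R -> R) (alpha : nat -> R) (thetas : p.-tuple R)
  (thhat : nat -> Om -> p.-tuple R) (V : 'M[R]_p) :
  is_lebesgue lam ->
  iid P X P0 ->
  measurable Theta ->
  tinterior Theta thetas ->
  (forall x t, 0 <= rho x t) ->
  measurable_fun setT (fun z : XX * p.-tuple R => rho z.1 z.2) ->
  (forall i, 0 < alpha i) ->
  (limn_esup (fun n => ((n%:R)^-1 * \sum_(i < n) alpha i ^+ 2)%:E) < +oo)%E ->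
  measurable_fun setT prior ->
  (forall t, 0 <= prior t) ->
  (\int[lam]_(t in Theta) (prior t)%:E = 1)%E ->
  (exists2 r : R, 0 < r & forall t, enorm (tsub t thetas) < r ->
     0 < prior t /\ tcont_at prior t) ->
  (forall n w, solves_est_eq rho alpha X Theta n w (thhat n w)) ->
  posdef V ->
  (forall K : set (p.-tuple R), tcompact K -> forall eps : R, 0 < eps ->
     (fun n => outerP P [set w | exists2 h, K h &
        eps < `|lan_rem rho alpha X V thetas thhat n w h|]) @ \oo --> 0%E) ->
  (forall r : nat -> R, r @ \oo --> +oo ->
     (fun n => (\int[P]_w (\int[lam]_(t in Theta)
        (\1_[set t | r n < enorm (tscale (Num.sqrt n%:R) (tsub t thetas))] t *
         mposterior rho alpha X lam Theta prior n w t)%:E))%E) @ \oo --> 0%E) ->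
  forall eps : R, 0 < eps ->
    (fun n => outerP P [set w | (eps%:E <
        dTV lam (mposterior rho alpha X lam Theta prior n w)
          (gauss_density (thhat n w) ((alphabar alpha n * n%:R)^-1 *: invmx V)))%E])
    @ \oo --> 0%E.
Proof.
move=> lamL [mX _ _] mTheta thI rho0 mrho alpha0 _ mprior prior0 prior1 [r r0 Hr] _.
have [pth cth] : 0 < prior thetas /\ tcont_at prior thetas.
  by apply: Hr; rewrite enormE (_ : tsub thetas thetas = tzero) /qnorm
    ?qform_tzero ?sqrtr0//; apply: trow_inj; rewrite !trowE subrr.
exact: (bernstein_von_mises _ _ _ _ _ _ P X lam).
Qed.
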